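(* Let $G$ be a linear causal system with real scalar impulse response $g:[0,\infty)\to\mathbb{R}$, i.e. with input-output relation $y(t)=\int_0^t g(t-s)u(s)\,ds$, and assume that $g\in L_1(0,\infty)\cap L_2(0,\infty)$ and $g'\in L_1(0,\infty)$. Then $G$ is dissipative if and only if for all $\epsilon>0$ and all $\tau>0$ there is a lossless/causal linear system $G_\tau$ with impulse response $g_\tau$ such that $$\|g-g_\tau\|_{L_2[0,\tau]}\le \epsilon .$$
   Context: All inputs and outputs are real scalar signals. Dissipative: the system $G$ with input-output relation $y(t)=\int_0^t g(t-s)u(s)\,ds$ is called dissipative (with respect to the work rate $w(t)=y(t)u(t)$) if $\int_0^T y(t)u(t)\,dt\ge 0$ for all $T\ge 0$ and all admissible inputs $u$; here admissible inputs are the real-valued $u\in L_2[0,T]$. Lossless/causal linear system: a finite-dimensional linear system of the form $$\dot x(t)=Jx(t)+Bu(t),\qquad y(t)=B^Tx(t),\qquad x(t)\in\mathbb{R}^n,$$ for some $n$, with scalar input $u(t)$ and scalar output $y(t)$, where $J\in\mathbb{R}^{n\times n}$ satisfies $J=-J^T$, $B\in\mathbb{R}^{n\times 1}$, and the pair $(J,B)$ is controllable. Its impulse response is $t\mapsto B^Te^{Jt}B$ for $t\ge 0$. The condition $g'\in L_1(0,\infty)$ means that $g$ is locally absolutely continuous on $[0,\infty)$ with integrable derivative. *)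

(* Defs.v *)
From HB Require Import structures.
From mathcomp Require Import all_boot all_order all_algebra.
From mathcomp Require Import all_classical all_reals all_analysis.
Set Implicit Arguments.
Unset Strict Implicit.
Unset Printing Implicit Defensive.
Import Order.TTheory GRing.Theory Num.Theory.
Import numFieldNormedType.Exports.

Local Open Scope classical_set_scope.
Local Open Scope ring_scope.

(* Signals on a subset D of the line are total functions R -> R of which only
   the values on D matter: below, f \_ D is f on D and 0 elsewhere.  The
   library's lebesgue_measure lives on the Borel sigma-algebra, so elements of
   L_p are given by Borel representatives. *)

Definition in_Lp (R : realType) (D : set R) (p : \bar R) (f : R -> R) : Prop :=
  f \_ D \in Lfun (@lebesgue_measure R) p.

Definition L2norm_on (R : realType) (D : set R) (f : R -> R) : \bar R :=
  'N[@lebesgue_measure R]_(2%:E)[EFin \o (f \_ D)]%E.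

(* Some of the intervals may be degenerate (a i = b i), which contributes
   nothing to either sum. *)
Definition abs_continuous_on (R : realType) (c d : R) (f : R -> R) : Prop :=
  forall e : R, 0 < e -> exists2 delta : R, 0 < delta &
    forall (m : nat) (a b : 'I_m -> R),
      (forall i, c <= a i /\ a i <= b i /\ b i <= d) ->
      trivIset setT (fun i => [set` `]a i, b i[]) ->
      \sum_(i < m) (b i - a i) < delta ->
      \sum_(i < m) `|f (b i) - f (a i)| < e.

(* An absolutely continuous function is differentiable almost everywhere, so
   the values of derive1 g at the points where g is not differentiable are
   irrelevant. *)
Definition derivative_in_L1 (R : realType) (g : R -> R) : Prop :=
  (forall b : R, 0 < b -> abs_continuous_on 0 b g) /\
  in_Lp `]0, +oo[ 1%E (derive1 g).

Definition response (R : realType) (g u : R -> R) (t : R) : R :=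
  \int[@lebesgue_measure R]_(s in `[0, t]) (g (t - s) * u s).

Definition admissible (R : realType) (T : R) (u : R -> R) : Prop :=
  in_Lp `[0, T] 2%:E u.

Definition dissipative (R : realType) (g : R -> R) : Prop :=
  forall T : R, 0 <= T -> forall u : R -> R, admissible T u ->
    0 <= \int[@lebesgue_measure R]_(t in `[0, T]) (response g u t * u t).

Definition expmx (R : realType) (n : nat) (A : 'M[R]_n) : 'M[R]_n :=
  limn (series (fun k : nat => (k`!%:R)^-1 *: A ^+ k)).

(* Since u is only in L_2, x' = A x + B u is understood in the sense of
   Caratheodory, i.e. in integrated form. *)
Definition is_trajectory (R : realType) (n : nat) (A : 'M[R]_n) (B : 'cV[R]_n)
    (T : R) (u : R -> R) (x : R -> 'cV[R]_n) : Prop :=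
  {within `[0, T], continuous x} /\
  forall t : R, 0 <= t <= T -> forall i : 'I_n,
    x t i 0 = x 0 i 0 +
      \int[@lebesgue_measure R]_(s in `[0, t]) ((A *m x s + u s *: B) i 0).

Definition controllable (R : realType) (n : nat) (A : 'M[R]_n) (B : 'cV[R]_n)
    : Prop :=
  forall x0 x1 : 'cV[R]_n, exists (T : R) (u : R -> R) (x : R -> 'cV[R]_n),
    [/\ 0 < T, admissible T u, is_trajectory A B T u x, x 0 = x0 & x T = x1].

(* x' = J x + B u, y = B^T x *)
Record lossless_system (R : realType) := LosslessSystem {
  ls_dim : nat;
  ls_dim_gt0 : (0 < ls_dim)%N;
  ls_J : 'M[R]_ls_dim;
  ls_B : 'cV[R]_ls_dim;
  ls_skew : ls_J = - ls_J^T;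
  ls_controllable : controllable ls_J ls_B
}.

Definition impulse_response (R : realType) (S : lossless_system R) (t : R) : R :=
  ((ls_B S)^T *m expmx (t *: ls_J S) *m ls_B S) 0 0.

(* Main.v *)
Require Import Defs.
From HB Require Import structures.
From mathcomp Require Import all_boot all_order all_algebra.
From mathcomp Require Import all_classical all_reals all_analysis.
From mathcomp Require Import measurable_realfun ring lra.
Set Implicit Arguments.
Unset Strict Implicit.
Unset Printing Implicit Defensive.
Import Order.TTheory GRing.Theory Num.Theory.
Import numFieldNormedType.Exports.
Local Open Scope classical_set_scope.
Local Open Scope ring_scope.

(** Both implications rest on the shape of lossless impulse responses.  As J is
skew-symmetric, the inner product of two solutions of x' = J x is constant;
hence k(t) = B^T e^(tJ) B satisfies k(t - s) = sum_i phi_i(t) phi_i(s), where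
phi(t) = e^(tJ) B ([impulse_responseB]).

Lossless systems are dissipative, and so are their limits.  The work done on
the input u over [0, T] by the response k is a sum of integrals over the
triangle s <= t of psi_i(t) psi_i(s), with psi_i = phi_i u.  By symmetry each
of them is half the square of the integral of psi_i, hence nonnegative
([lossless_work_ge0]).  For a fixed input the work depends continuously on the
response for the L2 norm on [0, T] ([work_le_L2]), so that nonnegativity
survives in the limit ([lossless_limit_dissipative]).

Dissipative systems are limits of lossless ones.  Feeding cos(w t), then
sin(w t), and adding the two works gives, since
cos(w t) cos(w s) + sin(w t) sin(w s) = cos(w (t - s)), that the integral of
(T - r) g(r) cos(w r) over [0, T] is nonnegative for all T and w
([dissipative_cosine_ge0]).  So the tapered response h(r) = (1 - r/T) g(r),
which is close to g on [0, tau] for T large, has a nonnegative cosine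
transform.  Convolve the even extension of h with the normalized kernel
K(y) = cos(a y)^(2N+1), where a = pi/(4T).  This K is a combination, with
nonnegative coefficients, of the cosines of the odd multiples of a y
([odd_cosine_sum_expr]), so the convolution at x is a sum of
c_k cos((2k+1) a x) with c_k >= 0.  When N grows, K concentrates at 0 within
[-2T, 2T], and the convolution tends to h uniformly on [0, tau]
([odd_cosine_approx]).  Once every c_k is slightly increased to be positive,
the sum is the impulse response of a bank of uncoupled oscillators, which is
controllable because its frequencies are distinct ([exists_oscillator_bank]). *)

(** * Calculus of one variable *)

Section Calculus.
Context {R : realType}.
Notation mu := (@lebesgue_measure R).
Implicit Types (f g F : R -> R) (a b t : R).

Lemma cvg_sumr (T : Type) (F : set_system T) (I : Type) (r : seq I) (P : pred I)
    (h : I -> T -> R) (l : I -> R) : Filter F ->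
  (forall i, P i -> h i x @[x --> F] --> l i) ->
  \sum_(i <- r | P i) h i x @[x --> F] --> \sum_(i <- r | P i) l i.
Proof. by move=> FF hl; apply: cvg_big => // -[x y]; exact: add_continuous. Qed.

Lemma continuous_translate f (c : R) :
  continuous f -> continuous (fun r => f (r + c)).
Proof.
move=> cf r; apply: (@continuous_comp _ _ _ (fun r => r + c) f); last exact: cf.
by apply: cvgD; [exact: cvg_id|exact: cvg_cst].
Qed.

Lemma continuous_reflect f (c : R) :
  continuous f -> continuous (fun r => f (c - r)).
Proof.
move=> cf r; apply: (@continuous_comp _ _ _ (fun r => c - r) f); last exact: cf.
by apply: cvgB; [exact: cvg_cst|exact: cvg_id].
Qed.

Lemma is_derive1_continuous f t (d : R) :
  is_derive t 1 f d -> {for t, continuous f}.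
Proof. by case=> df _; apply/differentiable_continuous/derivable1_diffP. Qed.

Lemma is_derive1D f g t (df dg : R) : is_derive t (1 : R) f df ->
  is_derive t (1 : R) g dg -> is_derive t (1 : R) (fun s => f s + g s) (df + dg).
Proof. exact: is_deriveD. Qed.

Lemma is_derive1B f g t (df dg : R) : is_derive t (1 : R) f df ->
  is_derive t (1 : R) g dg -> is_derive t (1 : R) (fun s => f s - g s) (df - dg).
Proof. exact: is_deriveB. Qed.

Lemma is_derive1M f g t (df dg : R) : is_derive t (1 : R) f df ->
  is_derive t (1 : R) g dg ->
  is_derive t (1 : R) (fun s => f s * g s) (df * g t + f t * dg).
Proof.
move=> Df Dg; apply: (is_derive_eq (is_deriveM Df Dg)).
by rewrite /GRing.scale/=; ring.
Qed.

Lemma is_derive1Z (c : R) f t (df : R) : is_derive t (1 : R) f df ->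
  is_derive t (1 : R) (fun s => c * f s) (c * df).
Proof. by move=> Df; exact: (is_deriveZ c Df). Qed.

Lemma is_derive1_sum n (f : 'I_n -> R -> R) t (df : 'I_n -> R) :
  (forall i, is_derive t (1 : R) (f i) (df i)) ->
  is_derive t (1 : R) (fun s => \sum_i f i s) (\sum_i df i).
Proof.
move=> Df; rewrite (_ : (fun s => _) = \sum_i f i); last by rewrite fct_sumE.
exact: is_derive_sum.
Qed.

Lemma is_derive1_reflect f (c t d : R) : is_derive (c - t) (1 : R) f d ->
  is_derive t (1 : R) (fun s => f (c - s)) (- d).
Proof.
move=> df; rewrite -mulrN1; apply: (@is_derive1_comp _ f (fun s => c - s)).
by rewrite -[-1]sub0r; exact: is_derive1B (is_derive_cst c t 1) (is_derive_id t 1).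
Qed.

Lemma is_derive1_translate f (c t d : R) : is_derive (t + c) (1 : R) f d ->
  is_derive t (1 : R) (fun s => f (s + c)) d.
Proof.
move=> df; rewrite -[d]mulr1; apply: (@is_derive1_comp _ f (fun s => s + c)).
by rewrite -[1 in X in is_derive _ _ _ X]addr0;
  exact: is_derive1D (is_derive_id t 1) (is_derive_cst c t 1).
Qed.

Lemma is_derive1_sinM (c t : R) :
  is_derive t (1 : R) (fun t => sin (c * t)) (c * cos (c * t)).
Proof.
rewrite mulrC; apply: (@is_derive1_comp _ sin (fun t => c * t)).
by rewrite -[X in is_derive _ _ _ X]mulr1; exact: (@is_deriveZ _ _ _ id c).
Qed.

Lemma is_derive1_cosM (c t : R) :
  is_derive t (1 : R) (fun t => cos (c * t)) (- c * sin (c * t)).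
Proof.
rewrite mulNr -mulrN mulrC; apply: (@is_derive1_comp _ cos (fun t => c * t)).
by rewrite -[X in is_derive _ _ _ X]mulr1; exact: (@is_deriveZ _ _ _ id c).
Qed.

Lemma integrable_segment f a b : {within `[a, b], continuous f} ->
  mu.-integrable `[a, b] (EFin \o f).
Proof. by move=> cf; apply: continuous_compact_integrable => //; exact: segment_compact. Qed.

Lemma continuous_integrable_segment f a b : continuous f ->
  mu.-integrable `[a, b] (EFin \o f).
Proof. by move=> cf; apply: integrable_segment; exact: continuous_subspaceT. Qed.

Lemma continuous_bounded_segment f b : 0 <= b -> continuous f ->
  exists2 C : R, 0 <= C & forall r, 0 <= r <= b -> `|f r| <= C.
Proof.
move=> b0 cf; have cnf : {within `[0, b], continuous (fun r => `|f r|)}.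
  by apply: continuous_subspaceT => r; apply: cvg_norm; exact: cf.
have [c _ hc] := EVT_max b0 cnf.
by exists `|f c| => // r rb; apply: hc; rewrite in_itv.
Qed.

Lemma Rintegral_is_derive f F a b : a <= b ->
  (forall t, a <= t <= b -> {for t, continuous f}) ->
  (forall t, a <= t <= b -> is_derive t 1 F (f t)) ->
  \int[mu]_(t in `[a, b]) f t = F b - F a.
Proof.
move=> + cf dF; rewrite le_eqVlt => /predU1P[<-|ab].
  by rewrite set_itv1 Rintegral_set1 subrr.
have cF t : a <= t <= b -> {for t, continuous F}.
  by move=> /dF; exact: is_derive1_continuous.
have cfab : {within `[a, b], continuous f}.
  by apply: continuous_in_subspaceT => t; rewrite inE/= in_itv/= => /cf.
rewrite /Rintegral (continuous_FTC2 (F := F))//.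
- split.
  + move=> t; rewrite in_itv/= => /andP[at_ tb].
    by apply: (@ex_derive _ _ _ _ _ _ _ (dF t _)); rewrite !ltW.
  + by apply: cvg_at_right_filter; apply: cF; rewrite lexx ltW.
  + by apply: cvg_at_left_filter; apply: cF; rewrite lexx ltW.
- move=> t; rewrite in_itv/= => /andP[at_ tb]; rewrite derive1E.
  by apply: (@derive_val _ _ _ _ _ _ _ (dF t _)); rewrite !ltW.
Qed.

(** The base point -1 puts 0 in the interior, so that F has two-sided
derivatives on all of [0, +oo[. *)
Lemma exists_primitive f : continuous f ->
  exists2 F : R -> R, F 0 = 0 & forall t, -1 < t -> is_derive t 1 F (f t).
Proof.
move=> cf; pose G t := \int[mu]_(s in `[-1, t]) f s.
exists (fun t => G t - G 0); first by rewrite subrr.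
move=> t t1; have tt1 : t < t + 1 by rewrite ltrDl.
have [dG G'] := continuous_FTC1_closed tt1
  (@continuous_integrable_segment f (-1) (t + 1) cf) t1 (cf t).
have dG' : is_derive t 1 G (f t) by split; [exact: dG|rewrite -G' derive1E].
rewrite -[f t]subr0.
exact: (@is_deriveB _ _ _ G (cst (G 0))).
Qed.

Lemma Rintegral_reflect f t : continuous f -> 0 <= t ->
  \int[mu]_(s in `[0, t]) f (t - s) = \int[mu]_(s in `[0, t]) f s.
Proof.
move=> cf t0; have [F F0 dF] := exists_primitive cf.
have dFt (s : R) : 0 <= s <= t -> is_derive s (1 : R) F (f s).
  by move=> /andP[s0 _]; apply: dF; lra.
have dFr (s : R) : 0 <= s <= t ->
    is_derive s (1 : R) (fun s => 0 - F (t - s)) (f (t - s)).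
  move=> /andP[s0 st]; have ts1 : -1 < t - s by lra.
  apply: (is_derive_eq (is_derive1B (is_derive_cst (0 : R) s 1)
    (is_derive1_reflect (dF _ ts1)))).
  by rewrite sub0r opprK.
rewrite (Rintegral_is_derive t0 (fun s _ => cf s) dFt).
rewrite (Rintegral_is_derive t0 _ dFr); first by rewrite subrr subr0 F0; ring.
by move=> s _; exact: continuous_reflect.
Qed.

Lemma Rintegral_segment_sum n (f : 'I_n -> R -> R) (D : set R) :
  measurable D -> (forall i, mu.-integrable D (EFin \o f i)) ->
  \int[mu]_(t in D) (\sum_(i < n) f i t) = \sum_(i < n) \int[mu]_(t in D) f i t.
Proof.
move=> mD intf; rewrite /Rintegral; under eq_integral do rewrite -sumEFin.
rewrite integral_sum//.
rewrite -sum_fine // => i _; rewrite integrable_fin_num//; exact: intf.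
Qed.

End Calculus.

(** * The L2 norm on a segment *)

Section L2Norm.
Context {R : realType}.
Notation mu := (@lebesgue_measure R).

Lemma eq_L2norm_on (D : set R) (f1 f2 : R -> R) :
  {in D, f1 =1 f2} -> L2norm_on D f1 = L2norm_on D f2.
Proof.
move=> f12; rewrite /L2norm_on; congr ('N[_]__[_])%E; apply/funext => x /=.
by rewrite !patchE; case: ifPn => // xD; rewrite f12.
Qed.

Lemma L2norm_on_le (D : set R) (f : R -> R) (e : R) : 0 <= e ->
  (L2norm_on D f <= e%:E)%E = (\int[mu]_(x in D) (f x ^+ 2)%:E <= (e ^+ 2)%:E)%E.
Proof.
move=> e0; rewrite /L2norm_on unlock.
rewrite (_ : (\int[_]__ _)%E = (\int[mu]_(x in D) (f x ^+ 2)%:E)%E); last first.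
  rewrite [RHS]integral_mkcond; apply: eq_integral => x _ /=.
  rewrite !patchE; case: ifPn => _ /=; last by rewrite normr0 powR0.
  by rewrite powR_mulrn// real_normK ?num_real.
have I0 : (0 <= \int[mu]_(x in D) (f x ^+ 2)%:E)%E.
  by apply: integral_ge0 => x _; rewrite lee_fin sqr_ge0.
rewrite poweR12_sqrt//; move: (integral _ _ _) I0 => [r| |]//= r0.
by rewrite !lee_fin -{1}(ger0_norm e0) -sqrtr_sqr ler_sqrt// sqr_ge0.
Qed.

Lemma L2norm_on_segment_le (f : R -> R) (tau e : R) : continuous f ->
  0 <= tau -> 0 <= e ->
  (forall x, 0 <= x <= tau -> `|f x| <= e) ->
  (L2norm_on `[0%R, tau] f <= (e * Num.sqrt tau)%:E)%E.
Proof.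
move=> cf tau0 e0 fe; rewrite L2norm_on_le ?mulr_ge0 ?sqrtr_ge0//.
have cf2 : continuous (fun x => f x ^+ 2).
  by move=> x; exact: (cvgM (cf x) (cf x)).
apply: (@le_trans _ _ (\int[mu]_(x in `[0%R, tau]) (e ^+ 2)%:E)%E).
  apply: ge0_le_integral => //.
  - by move=> x _; rewrite lee_fin sqr_ge0.
  - by case/integrableP: (@continuous_integrable_segment R _ 0 tau cf2).
  - by move=> x; rewrite /= in_itv/= => xt; rewrite lee_fin -[leLHS]real_normK ?num_real//
      lerXn2r ?nnegrE// fe.
rewrite integral_cst//= lebesgue_measure_itv/= lte_fin.
case: ifPn => [tau_gt0|]; last by rewrite mule0 lee_fin sqr_ge0.
by rewrite oppr0 addr0 -EFinM lee_fin exprMn sqr_sqrtr.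
Qed.

End L2Norm.

(** * The matrix exponential and flows of skew-symmetric matrices *)

Section MatrixExponential.
Context {R : realType} (n : nat).
Implicit Types (A : 'M[R]_n) (B : 'cV[R]_n).

(** The coefficients of the power series in t of the i-th entry of
e^(tA) B. *)
Definition expmx_coeff A B (i : 'I_n) (k : nat) : R :=
  (A ^+ k *m B) i 0 / k`!%:R.

Lemma norm_expr_mulmx_le A B k i :
  `|(A ^+ k *m B) i 0| <=
    (\sum_i' \sum_j `|A i' j|) ^+ k * \sum_j `|B j 0|.
Proof.
elim: k i => [|k IHk] i.
  by rewrite expr0 mul1mx mul1r (bigD1 i)//= lerDl sumr_ge0.
rewrite !exprS -mulmxA mxE (le_trans (ler_norm_sum _ _ _))//.
rewrite -mulrA (@le_trans _ _
  (\sum_j `|A i j| * ((\sum_i' \sum_j `|A i' j|) ^+ k * \sum_j `|B j 0|)))//.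
  by apply: ler_sum => j _; rewrite normrM ler_wpM2l.
rewrite -mulr_suml ler_wpM2r//.
  rewrite mulr_ge0 ?exprn_ge0 ?sumr_ge0// => ? _; exact: sumr_ge0.
rewrite [leRHS](bigD1 i)//= lerDl sumr_ge0// => ? _; exact: sumr_ge0.
Qed.

Lemma is_cvg_expmx_pseries A B i x : cvgn (pseries (expmx_coeff A B i) x).
Proof.
apply: normed_cvg.
pose M : R := \sum_i' \sum_j `|A i' j|.
pose b : R := \sum_j `|B j 0|.
apply: (@series_le_cvg _ _ (b *: exp_coeff (M * `|x|))) => /=.
- by [].
- move=> k; rewrite fctE; apply: mulr_ge0; first exact: sumr_ge0.
  apply: exp_coeff_ge0; apply: mulr_ge0 => //.
  by apply: sumr_ge0 => ? _; exact: sumr_ge0.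
- move=> k; rewrite fctE /exp_coeff /= exprMn.
  rewrite [leRHS](_ : _ = (M ^+ k * b) * (k`!%:R^-1 * `|x| ^+ k)); last first.
    by rewrite /GRing.scale/=; ring.
  rewrite /expmx_coeff !normrM normfV normr_nat normrX -mulrA ler_wpM2r//.
  exact: norm_expr_mulmx_le.
- exact/is_cvg_seriesZ/is_cvg_series_exp_coeff.
Qed.

(** Termwise differentiation only replaces B by A B: convergence for
arbitrary B therefore also covers the first two derived series, as the theorem
on derivatives of power series requires. *)
Lemma pseries_diffs_expmx_coeff A B i :
  pseries_diffs (expmx_coeff A B i) = expmx_coeff A (A *m B) i.
Proof.
apply/funext => k; rewrite /pseries_diffs /expmx_coeff exprSr -mulmxA.
by rewrite factS natrM invfM; field; rewrite pnatr_eq0 -lt0n fact_gt0 /=.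
Qed.

Lemma cvg_mx_entries (T : Type) (F : set_system T) m p
    (u : T -> 'M[R]_(m, p)) (L : 'M[R]_(m, p)) : Filter F ->
  (forall i j, u k i j @[k --> F] --> L i j) -> u @ F --> L.
Proof.
move=> FF uL; apply/cvg_mx_entourageP => E entE.
have : \forall k \near F, forall ij : 'I_m * 'I_p,
    E (L ij.1 ij.2, u k ij.1 ij.2).
  apply: filter_forall => ij; have := uL ij.1 ij.2.
  by move/cvg_app_entourageP => /(_ _ entE).
by apply: filterS => k Eu i j; rewrite inE; exact: (Eu (i, j)).
Qed.

Lemma exprZmx (t : R) A k : (t *: A) ^+ k = t ^+ k *: A ^+ k.
Proof.
elim: k => [|k IHk]; first by rewrite !expr0 scale1r.
by rewrite !exprS IHk -!mulmxE -scalemxAl -scalemxAr scalerA.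
Qed.

Lemma expmx_mulE A B i t :
  (expmx (t *: A) *m B) i 0 = limn (pseries (expmx_coeff A B i) t).
Proof.
pose u := series (fun k : nat => (k`!%:R)^-1 *: (t *: A) ^+ k).
(* the columns of the exponential are its products with basis vectors *)
pose e (j : 'I_n) : 'cV[R]_n := delta_mx j 0.
have entry k r s : u k r s = pseries (expmx_coeff A (e s) r) t k.
  rewrite /u /pseries /series /= summxE; apply: eq_bigr => l _.
  by rewrite exprZmx /expmx_coeff -colE !mxE; ring.
have cu : u @ \oo --> (\matrix_(r, s) limn (pseries (expmx_coeff A (e s) r) t) : 'M[R]_n).
  apply: cvg_mx_entries => r s; rewrite mxE.
  under eq_fun do rewrite entry.
  exact: is_cvg_expmx_pseries.
have -> : expmx (t *: A) = \matrix_(r, s) limn (pseries (expmx_coeff A (e s) r) t).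
  exact: cvg_lim cu.
rewrite mxE; apply/esym/cvg_lim => //.
have -> : pseries (expmx_coeff A B i) t =
    (fun k => \sum_j pseries (expmx_coeff A (e j) i) t k * B j 0).
  apply/funext => k; rewrite /pseries /series /=.
  under [RHS]eq_bigr do rewrite mulr_suml.
  rewrite exchange_big/=; apply: eq_bigr => l _.
  rewrite /expmx_coeff mxE !mulr_suml; apply: eq_bigr => j _.
  by rewrite -colE !mxE; ring.
apply: cvg_sumr => j _; rewrite mxE; apply: cvgMr_tmp.
exact: is_cvg_expmx_pseries.
Qed.

(** Working entrywise on e^(tA) B reduces the differential equation to the
differentiation of scalar power series. *)
Lemma is_derive_expmx A B i t :
  is_derive t (1 : R) (fun t => (expmx (t *: A) *m B) i 0)
    ((A *m (expmx (t *: A) *m B)) i 0).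
Proof.
rewrite (_ : (fun t => _) = (fun t => limn (pseries (expmx_coeff A B i) t))); last first.
  by apply/funext => s; exact: expmx_mulE.
have -> : (A *m (expmx (t *: A) *m B)) i 0 =
    limn (pseries (pseries_diffs (expmx_coeff A B i)) t).
  rewrite mxE; under eq_bigr do rewrite expmx_mulE.
  apply/esym/cvg_lim => //.
  have -> : pseries (pseries_diffs (expmx_coeff A B i)) t =
      (fun k => \sum_j A i j * pseries (expmx_coeff A B j) t k).
    apply/funext => k; rewrite pseries_diffs_expmx_coeff /pseries /series /=.
    under [RHS]eq_bigr do rewrite mulr_sumr.
    rewrite exchange_big/=; apply: eq_bigr => l _.
    rewrite /expmx_coeff mulmxA [A ^+ l *m A](esym (exprSr A l)) exprS -mulmxA.
    rewrite mxE !mulr_suml; apply: eq_bigr => j _; ring.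
  apply: cvg_sumr => j _; apply: cvgMl_tmp.
  exact: is_cvg_expmx_pseries.
apply: (@pseries_snd_diffs _ _ (`|t| + 1)).
- exact: is_cvg_expmx_pseries.
- rewrite pseries_diffs_expmx_coeff; exact: is_cvg_expmx_pseries.
- rewrite !pseries_diffs_expmx_coeff; exact: is_cvg_expmx_pseries.
- by rewrite [ltRHS]ger0_norm ?addr_ge0// ltrDl.
Qed.

Lemma expmx0_mul A B : expmx (0 *: A) *m B = B.
Proof.
apply/colP => i; rewrite expmx_mulE; apply: cvg_lim => //.
rewrite -(cvg_shiftS (pseries _ _)); apply: cvg_near_cst; apply: nearW => k.
rewrite /pseries /series /= big_nat_recl// big1 ?addr0.
  by rewrite /expmx_coeff expr0 mul1mx expr0 fact0 divr1 mulr1.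
by move=> j _; rewrite exprS mul0r mulr0.
Qed.

End MatrixExponential.

Section SkewFlow.
Context {R : realType} (n : nat).
Variable (J : 'M[R]_n).
Hypothesis J_skew : J = - J^T.
Implicit Types (x y : R -> 'cV[R]_n).

Definition solves_ode x := forall t i,
  is_derive t (1 : R) (fun t => x t i 0) ((J *m x t) i 0).

(** The derivative of x^T y along the flow is x^T (J^T + J) y = 0. *)
Lemma skew_flow_dot_const x y s t : solves_ode x -> solves_ode y ->
  ((x s)^T *m y s) 0 0 = ((x t)^T *m y t) 0 0.
Proof.
move=> dx dy; have := @is_derive_0_is_cst R (fun t => ((x t)^T *m y t) 0 0) s t.
apply=> {}t.
rewrite (_ : (fun t => _) = \sum_(i < n) ((fun t => x t i 0) * (fun t => y t i 0))); last first.
  by apply/funext => r; rewrite mxE fct_sumE; apply: eq_bigr => i _; rewrite mxE.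
have dxi i := dx t i; have dyi i := dy t i.
apply: is_derive_eq.
transitivity (((x t)^T *m (J *m y t) + (J *m x t)^T *m y t) 0 0).
  rewrite !mxE -big_split/=; apply: eq_bigr => i _.
  rewrite /GRing.scale/= [(x t)^T 0 i]mxE [(J *m x t)^T 0 i]mxE; congr (_ + _); exact: mulrC.
by rewrite trmx_mul -mulmxA -mulmxDr -mulmxDl {1}J_skew addNr mul0mx mulmx0 mxE.
Qed.

Lemma solves_ode_shift x r : solves_ode x -> solves_ode (fun t => x (t + r)).
Proof.
move=> dx t i; exact: (is_derive1_translate (f := fun t => x t i 0) (dx (t + r) i)).
Qed.

Lemma solves_odeB x y : solves_ode x -> solves_ode y ->
  solves_ode (fun t => x t - y t).
Proof.
move=> dx dy t i; have dxi := dx t i; have dyi := dy t i.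
rewrite (_ : (fun t => _) = (fun t => x t i 0) - (fun t => y t i 0)); last first.
  by apply/funext => s; rewrite !mxE.
have -> : (J *m (x t - y t)) i 0 = (J *m x t) i 0 - (J *m y t) i 0.
  by rewrite mulmxBr [LHS]mxE [X in _ + X]mxE.
exact: is_deriveB.
Qed.

(** The squared norm of x - y is conserved and vanishes at time 0. *)
Lemma skew_flow_uniq x y : solves_ode x -> solves_ode y -> x 0 = y 0 -> x =1 y.
Proof.
move=> dx dy xy0 t; have dz := solves_odeB dx dy.
have := skew_flow_dot_const t 0 dz dz; rewrite xy0 subrr mulmx0 mxE => z0.
apply/eqP; rewrite -subr_eq0; apply/eqP/colP => i; apply/eqP.
move: z0; rewrite mxE => /eqP; rewrite psumr_eq0.
  by move=> /allP/(_ i); rewrite mem_index_enum !mxE -expr2 sqrf_eq0 => /(_ isT).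
by move=> j _; rewrite mxE -expr2 sqr_ge0.
Qed.

Lemma expmx_solves_ode B : solves_ode (fun t => expmx (t *: J) *m B).
Proof. by move=> t i; exact: is_derive_expmx. Qed.

End SkewFlow.

Section ImpulseResponse.
Context {R : realType} (S : lossless_system R).
Let J := ls_J S.
Let B := ls_B S.

Definition free_response (t : R) : 'cV[R]_(ls_dim S) := expmx (t *: J) *m B.

(** The solutions r |-> phi (r + (t - s)) and phi, where phi is the free
response, have the same inner product at r = 0, where it is k (t - s) because
phi 0 = B, and at r = s. *)
Lemma impulse_responseB s t :
  impulse_response S (t - s) = \sum_i free_response t i 0 * free_response s i 0.
Proof.
have odeF : solves_ode J free_response by exact: expmx_solves_ode.
have := @skew_flow_dot_const _ _ J (ls_skew S) _ _ 0 s (solves_ode_shift (t - s) odeF) odeF.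
rewrite add0r [free_response 0]expmx0_mul (addrC s) subrK.
rewrite /impulse_response -/J -/B -mulmxA -/(free_response _) => e.
have tr (M : 'M[R]_1) : M 0 0 = M^T 0 0 by rewrite mxE.
rewrite tr trmx_mul trmxK e mxE; apply: eq_bigr => i _.
by rewrite mxE.
Qed.

Lemma continuous_impulse_response : continuous (impulse_response S).
Proof.
rewrite (_ : impulse_response S =
    fun t => \sum_i free_response t i 0 * free_response 0 i 0); last first.
  by apply/funext => t; rewrite -impulse_responseB subr0.
move=> t; apply: cvg_sumr => i _; apply: cvgMr_tmp.
exact: is_derive1_continuous (expmx_solves_ode _ _ t i).
Qed.

End ImpulseResponse.

(** * Trajectories and banks of harmonic oscillators *)

Section Trajectories.
Context {R : realType}.
Notation mu := (@lebesgue_measure R).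

Lemma continuous_admissible (T : R) (u : R -> R) : continuous u -> admissible T u.
Proof.
move=> cu; have mu_u : measurable_fun `[0, T] u.
  by apply: measurable_funTS; exact: continuous_measurable_fun.
rewrite /admissible /in_Lp inE; apply/andP; split; rewrite inE /=.
  apply/(measurable_restrictT _ _).1 => //.
rewrite /finite_norm unlock; apply: poweR_lty.
rewrite (_ : (\int[_]__ _)%E = (\int[mu]_(x in `[0%R, T]) (u x ^+ 2)%R%:E)%E).
  apply: integrable_lty => //.
  by apply: continuous_integrable_segment => x; exact: (cvgM (cu x) (cu x)).
rewrite [RHS]integral_mkcond; apply: eq_integral => x _ /=.
rewrite !patchE; case: ifPn => _ /=; last by rewrite normr0 powR0.
by rewrite powR_mulrn// real_normK ?num_real.
Qed.

Lemma is_trajectory_ode n (A : 'M[R]_n) (B : 'cV[R]_n) (T : R) (u : R -> R)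
    (x : R -> 'cV[R]_n) : continuous u ->
  (forall t i, is_derive t (1 : R) (fun t => x t i 0) ((A *m x t + u t *: B) i 0)) ->
  is_trajectory A B T u x.
Proof.
move=> cu dx; have cx i : continuous (fun t => x t i 0).
  by move=> t; exact: is_derive1_continuous (dx t i).
split.
  apply: continuous_subspaceT => t; apply: cvg_mx_entries => i j.
  by rewrite ord1; exact: cx.
move=> t /andP[t0 _] i.
rewrite (Rintegral_is_derive t0 (F := fun t => x t i 0)).
- by rewrite subrKC.
- move=> s _.
  rewrite (_ : (fun s => _) = (fun s => \sum_j A i j * x s j 0 + u s * B i 0)); last first.
    by apply/funext => r; rewrite !mxE.
  apply: cvgD; last by apply: cvgMr_tmp; exact: cu.
  by apply: cvg_sumr => j _; apply: cvgMl_tmp; exact: cx.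
Qed.

End Trajectories.

Section OscillatorBank.
Context {R : realType} (N : nat).
Variables (w : 'rV[R]_N) (b : 'cV[R]_N).

(** N uncoupled oscillators p_i' = - w_i q_i + b_i u, q_i' = w_i p_i, with all
the p_i placed before all the q_i. *)
Definition bank_J : 'M[R]_(N + N) :=
  block_mx 0 (- diag_mx w) (diag_mx w) 0.

Definition bank_B : 'cV[R]_(N + N) := col_mx b 0.

Definition bank_state (p q : 'I_N -> R -> R) (t : R) : 'cV[R]_(N + N) :=
  col_mx (\col_i p i t) (\col_i q i t).

Lemma bank_J_skew : bank_J = - bank_J^T.
Proof.
by rewrite /bank_J tr_block_mx !trmx0 [(- _)^T]linearN/= tr_diag_mx opp_block_mx
  !oppr0 opprK.
Qed.

Lemma bank_vector_fieldu p q t c i :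
  (bank_J *m bank_state p q t + c *: bank_B) (lshift N i) 0 =
  - w 0 i * q i t + c * b i 0.
Proof.
rewrite /bank_J /bank_state mul_block_col !mul0mx !add0r scale_col_mx add_col_mx.
rewrite col_mxEu mulNmx mul_diag_mx !mxE; ring.
Qed.

Lemma bank_vector_fieldd p q t c i :
  (bank_J *m bank_state p q t + c *: bank_B) (rshift N i) 0 = w 0 i * p i t.
Proof.
rewrite /bank_J /bank_state mul_block_col !mul0mx !addr0 scale_col_mx add_col_mx.
rewrite col_mxEd scaler0 addr0 mul_diag_mx !mxE; ring.
Qed.

Lemma is_derive_bank_state p q (u : R -> R) t :
  (forall i, is_derive t (1 : R) (p i) (- w 0 i * q i t + u t * b i 0)) ->
  (forall i, is_derive t (1 : R) (q i) (w 0 i * p i t)) ->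
  forall i, is_derive t (1 : R) (fun t => bank_state p q t i 0)
    ((bank_J *m bank_state p q t + u t *: bank_B) i 0).
Proof.
move=> dp dq i; case: (split_ordP i) => j ->.
  rewrite bank_vector_fieldu (_ : (fun t => _) = p j)//.
  by apply/funext => s; rewrite col_mxEu mxE.
rewrite bank_vector_fieldd (_ : (fun t => _) = q j)//.
by apply/funext => s; rewrite col_mxEd mxE.
Qed.

(** From the initial state B the i-th oscillator turns on the circle
b_i (cos w_i t, sin w_i t); the gain b_i enters once more in the output. *)
Lemma bank_impulse_response t :
  (bank_B^T *m expmx (t *: bank_J) *m bank_B) 0 0 =
  \sum_i b i 0 ^+ 2 * cos (w 0 i * t).
Proof.
pose y := bank_state (fun i t => b i 0 * cos (w 0 i * t)) (fun i t => b i 0 * sin (w 0 i * t)).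
have yode : solves_ode bank_J y.
  move=> s.
  have dp j : is_derive s (1 : R) (fun t => b j 0 * cos (w 0 j * t))
      (- w 0 j * (b j 0 * sin (w 0 j * s)) + 0 * b j 0).
    apply: (is_derive_eq (is_derive1Z (b j 0) (is_derive1_cosM (w 0 j) s))); ring.
  have dq j : is_derive s (1 : R) (fun t => b j 0 * sin (w 0 j * t))
      (w 0 j * (b j 0 * cos (w 0 j * s))).
    apply: (is_derive_eq (is_derive1Z (b j 0) (is_derive1_sinM (w 0 j) s))); ring.
  by move=> i; have := is_derive_bank_state (u := fun=> 0) dp dq i; rewrite scale0r addr0.
have y0 : expmx (0 *: bank_J) *m bank_B = y 0.
  rewrite expmx0_mul /y /bank_state /bank_B; congr col_mx; apply/colP => i.
    by rewrite !mxE mulr0 cos0 mulr1.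
  by rewrite !mxE mulr0 sin0 mulr0.
rewrite -mulmxA (skew_flow_uniq bank_J_skew (expmx_solves_ode _ _) yode y0).
rewrite /y /bank_state /bank_B tr_col_mx mul_row_col trmx0 mul0mx addr0 mxE.
by apply: eq_bigr => i _; rewrite !mxE; ring.
Qed.

End OscillatorBank.

Section TrigPrimitives.
Context {R : realType}.
Implicit Types (v t T : R).

(** These primitives are later taken at differences of frequencies, so the
value 0 of v does occur. *)
Definition cos_primitive v t : R := if v == 0 then t else sin (v * t) / v.
Definition sin_primitive v t : R := if v == 0 then 0 else (1 - cos (v * t)) / v.

Lemma is_derive_cos_primitive v t :
  is_derive t (1 : R) (cos_primitive v) (cos (v * t)).
Proof.
rewrite /cos_primitive; have [->|v0] := eqVneq v 0.
  by rewrite mul0r cos0; exact: is_derive_id.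
apply: (is_derive_eq (is_derive1M (is_derive1_sinM v t) (is_derive_cst v^-1 t 1))).
by rewrite mulr0 addr0 mulrAC divff ?mul1r.
Qed.

Lemma is_derive_sin_primitive v t :
  is_derive t (1 : R) (sin_primitive v) (sin (v * t)).
Proof.
rewrite /sin_primitive; have [->|v0] := eqVneq v 0.
  by rewrite mul0r sin0; exact: is_derive_cst.
apply: (is_derive_eq (is_derive1M
  (is_derive1B (is_derive_cst (1 : R) t 1) (is_derive1_cosM v t)) (is_derive_cst v^-1 t 1))).
by rewrite mulr0 addr0 mulNr sub0r opprK mulrAC divff ?mul1r.
Qed.

Lemma cos_primitive0 v : cos_primitive v 0 = 0.
Proof. by rewrite /cos_primitive mulr0 sin0 mul0r if_same. Qed.

Lemma sin_primitive0 v : sin_primitive v 0 = 0.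
Proof. by rewrite /sin_primitive mulr0 cos0 subrr mul0r if_same. Qed.

Lemma cos_primitive_turn v T : sin (v * T) = 0 ->
  cos_primitive v T = if v == 0 then T else 0.
Proof. by rewrite /cos_primitive => ->; rewrite mul0r. Qed.

Lemma sin_primitive_turn v T : cos (v * T) = 1 -> sin_primitive v T = 0.
Proof. by rewrite /sin_primitive => ->; rewrite subrr mul0r if_same. Qed.

End TrigPrimitives.

Section BankControllability.
Context {R : realType} (N : nat).
Variables (a : R) (m : 'I_N -> nat) (b : 'cV[R]_N).
Hypotheses (a_gt0 : 0 < a) (m_inj : injective m) (m_gt0 : forall i, (0 < m i)%N).
Hypothesis b_neq0 : forall i, b i 0 != 0.
Let w : 'rV[R]_N := \row_i (a * (m i)%:R).
Let wE i : w 0 i = a * (m i)%:R. Proof. by rewrite mxE. Qed.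
Let T : R := pi *+ 2 / a.

Let cos_turn i : cos (w 0 i * T) = 1.
Proof.
rewrite wE /T (_ : _ * _ = 0 + pi *+ 2 *+ m i); last first.
  by rewrite add0r -[RHS]mulr_natr; field; rewrite gt_eqF.
by rewrite (periodicn (@cosD2pi R)) cos0.
Qed.

Let sin_turn i : sin (w 0 i * T) = 0.
Proof.
rewrite wE /T (_ : _ * _ = 0 + pi *+ 2 *+ m i); last first.
  by rewrite add0r -[RHS]mulr_natr; field; rewrite gt_eqF.
by rewrite (periodicn (@sinD2pi R)) sin0.
Qed.

Let wD_neq0 i k : w 0 i + w 0 k != 0.
Proof.
by apply: lt0r_neq0; rewrite !wE addr_gt0// mulr_gt0// ltr0n.
Qed.

Let wB_eq0 i k : (w 0 i - w 0 k == 0) = (i == k).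
Proof.
rewrite subr_eq0 !wE; apply/eqP/eqP => [|->//].
by move=> /(mulfI (lt0r_neq0 a_gt0))/eqP; rewrite eqr_nat => /eqP/m_inj.
Qed.

Section Steering.
Variables (al be : 'I_N -> R).

(** The input that moves the bank between two prescribed states; its
coefficients are found by orthogonality in [bank_controllable]. *)
Definition steering (t : R) : R :=
  \sum_k (al k * cos (w 0 k * t) + be k * sin (w 0 k * t)).

(** The primitive of cos(w_i t) steering(t) that vanishes at 0, expanded with
the product-to-sum formulas. *)
Definition steering_cos i (t : R) : R := \sum_k
  (al k / 2 * (cos_primitive (w 0 i - w 0 k) t + cos_primitive (w 0 i + w 0 k) t) +
   be k / 2 * (sin_primitive (w 0 i + w 0 k) t - sin_primitive (w 0 i - w 0 k) t)).

Definition steering_sin i (t : R) : R := \sum_k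
  (al k / 2 * (sin_primitive (w 0 i + w 0 k) t + sin_primitive (w 0 i - w 0 k) t) +
   be k / 2 * (cos_primitive (w 0 i - w 0 k) t - cos_primitive (w 0 i + w 0 k) t)).

Lemma is_derive_steering_cos i t :
  is_derive t (1 : R) (steering_cos i) (cos (w 0 i * t) * steering t).
Proof.
rewrite /steering mulr_sumr; apply: is_derive1_sum => k.
apply: (is_derive_eq (is_derive1D
  (is_derive1Z _ (is_derive1D (is_derive_cos_primitive _ _) (is_derive_cos_primitive _ _)))
  (is_derive1Z _ (is_derive1B (is_derive_sin_primitive _ _) (is_derive_sin_primitive _ _))))).
by rewrite !mulrBl !mulrDl cosB cosD sinB sinD; field.
Qed.

Lemma is_derive_steering_sin i t :
  is_derive t (1 : R) (steering_sin i) (sin (w 0 i * t) * steering t).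
Proof.
rewrite /steering mulr_sumr; apply: is_derive1_sum => k.
apply: (is_derive_eq (is_derive1D
  (is_derive1Z _ (is_derive1D (is_derive_sin_primitive _ _) (is_derive_sin_primitive _ _)))
  (is_derive1Z _ (is_derive1B (is_derive_cos_primitive _ _) (is_derive_cos_primitive _ _))))).
by rewrite !mulrBl !mulrDl cosB cosD sinB sinD; field.
Qed.

Lemma steering_cos0 i : steering_cos i 0 = 0.
Proof.
rewrite /steering_cos big1// => k _.
by rewrite !cos_primitive0 !sin_primitive0 subrr addr0 !mulr0 addr0.
Qed.

Lemma steering_sin0 i : steering_sin i 0 = 0.
Proof.
rewrite /steering_sin big1// => k _.
by rewrite !cos_primitive0 !sin_primitive0 subrr addr0 !mulr0 addr0.
Qed.

Let cosB_turn i k : cos ((w 0 i - w 0 k) * T) = 1.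
Proof. by rewrite mulrBl cosB !cos_turn !sin_turn mulr0 addr0 mulr1. Qed.
Let cosD_turn i k : cos ((w 0 i + w 0 k) * T) = 1.
Proof. by rewrite mulrDl cosD !cos_turn !sin_turn mulr0 subr0 mulr1. Qed.
Let sinB_turn i k : sin ((w 0 i - w 0 k) * T) = 0.
Proof. by rewrite mulrBl sinB !cos_turn !sin_turn mulr0 mul0r subrr. Qed.
Let sinD_turn i k : sin ((w 0 i + w 0 k) * T) = 0.
Proof. by rewrite mulrDl sinD !cos_turn !sin_turn mulr0 mul0r addr0. Qed.

(** Orthogonality of the trigonometric system over the common period T. *)
Lemma steering_cos_turn i : steering_cos i T = al i / 2 * T.
Proof.
rewrite /steering_cos (bigD1 i)//= big1 ?addr0; last first.
  move=> k ki; rewrite !sin_primitive_turn// !cos_primitive_turn//.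
  by rewrite wB_eq0 eq_sym (negPf ki) (negPf (wD_neq0 _ _)) subrr addr0 !mulr0 addr0.
rewrite !sin_primitive_turn// !cos_primitive_turn//.
by rewrite wB_eq0 eqxx (negPf (wD_neq0 _ _)) subrr addr0 mulr0 addr0.
Qed.

Lemma steering_sin_turn i : steering_sin i T = be i / 2 * T.
Proof.
rewrite /steering_sin (bigD1 i)//= big1 ?addr0; last first.
  move=> k ki; rewrite !sin_primitive_turn// !cos_primitive_turn//.
  by rewrite wB_eq0 eq_sym (negPf ki) (negPf (wD_neq0 _ _)) subrr addr0 !mulr0 addr0.
rewrite !sin_primitive_turn// !cos_primitive_turn//.
by rewrite wB_eq0 eqxx (negPf (wD_neq0 _ _)) subr0 addr0 mulr0 add0r.
Qed.

Lemma continuous_steering : continuous steering.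
Proof.
move=> t; apply: cvg_sumr => k _; apply: cvgD; apply: cvgMl_tmp.
  exact: is_derive1_continuous (is_derive1_cosM _ _).
exact: is_derive1_continuous (is_derive1_sinM _ _).
Qed.

End Steering.

(** In the frame that rotates with the i-th oscillator the state is (X_i, Y_i),
whose derivative is b_i u (cos w_i t, - sin w_i t).  After the common period T
of all the oscillators the frame is back in place, and by orthogonality X_i and
Y_i have moved by amounts that depend only on the i-th coefficients al_i and
be_i of the input.  These can therefore be chosen oscillator by oscillator. *)
Lemma bank_controllable : controllable (bank_J w) (bank_B b).
Proof.
move=> x0 x1.
have T_gt0 : 0 < T by rewrite divr_gt0// pmulrn_lgt0// pi_gt0.
pose p0 (i : 'I_N) : R := x0 (lshift N i) 0; pose q0 (i : 'I_N) : R := x0 (rshift N i) 0.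
pose p1 (i : 'I_N) : R := x1 (lshift N i) 0; pose q1 (i : 'I_N) : R := x1 (rshift N i) 0.
pose al i := (p1 i - p0 i) / (b i 0 / 2 * T).
pose be i := (q0 i - q1 i) / (b i 0 / 2 * T).
pose X i t := p0 i + b i 0 * steering_cos al be i t.
pose Y i t := q0 i - b i 0 * steering_sin al be i t.
pose p i t := cos (w 0 i * t) * X i t - sin (w 0 i * t) * Y i t.
pose q i t := sin (w 0 i * t) * X i t + cos (w 0 i * t) * Y i t.
pose u := steering al be.
have dX i t : is_derive t (1 : R) (X i) (b i 0 * (cos (w 0 i * t) * u t)).
  apply: (is_derive_eq (is_derive1D (is_derive_cst (p0 i) t 1)
    (is_derive1Z _ (is_derive_steering_cos al be i t)))).
  by rewrite add0r.
have dY i t : is_derive t (1 : R) (Y i) (- (b i 0 * (sin (w 0 i * t) * u t))).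
  apply: (is_derive_eq (is_derive1B (is_derive_cst (q0 i) t 1)
    (is_derive1Z _ (is_derive_steering_sin al be i t)))).
  by rewrite sub0r.
have cs i t : cos (w 0 i * t) ^+ 2 = 1 - sin (w 0 i * t) ^+ 2 by rewrite cos2sin2.
have dp t i : is_derive t (1 : R) (p i) (- w 0 i * q i t + u t * b i 0).
  apply: (is_derive_eq (is_derive1B
    (is_derive1M (is_derive1_cosM (w 0 i) t) (dX i t))
    (is_derive1M (is_derive1_sinM (w 0 i) t) (dY i t)))).
  rewrite /q; have := cs i t; move: (cos _) (sin _) => c s cE.
  transitivity (- w 0 i * (s * X i t + c * Y i t) + u t * b i 0 * (c ^+ 2 + s ^+ 2)).
    by ring.
  by rewrite cE subrK mulr1.
have dq t i : is_derive t (1 : R) (q i) (w 0 i * p i t).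
  apply: (is_derive_eq (is_derive1D
    (is_derive1M (is_derive1_sinM (w 0 i) t) (dX i t))
    (is_derive1M (is_derive1_cosM (w 0 i) t) (dY i t)))).
  by rewrite /p; ring.
exists T, u, (bank_state p q); split => //.
- exact/continuous_admissible/continuous_steering.
- apply: is_trajectory_ode; first exact: continuous_steering.
  by move=> t; exact: is_derive_bank_state (dp t) (dq t).
- rewrite -[RHS]vsubmxK /bank_state; congr col_mx; apply/colP => i; rewrite !mxE.
    by rewrite /p /X mulr0 cos0 sin0 steering_cos0 mul1r !mulr0 mul0r subr0 addr0.
  by rewrite /q /Y mulr0 cos0 sin0 steering_sin0 mul1r !mulr0 mul0r subr0 add0r.
- rewrite -[RHS]vsubmxK /bank_state; congr col_mx; apply/colP => i; rewrite !mxE.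
    rewrite /p cos_turn sin_turn mul1r mul0r subr0 /X steering_cos_turn -/(p1 i) /al.
    by field; rewrite b_neq0 gt_eqF.
  rewrite /q cos_turn sin_turn mul1r mul0r add0r /Y steering_sin_turn -/(q1 i) /be.
  by field; rewrite b_neq0 gt_eqF.
Qed.

End BankControllability.

Lemma exists_oscillator_bank (R : realType) (N : nat) (a : R) (m : 'I_N -> nat)
    (c : 'I_N -> R) : (0 < N)%N -> 0 < a -> injective m ->
    (forall i, 0 < m i)%N -> (forall i, 0 < c i) ->
  exists S : lossless_system R,
    forall t, impulse_response S t = \sum_i c i * cos (a * (m i)%:R * t).
Proof.
move=> N0 a0 m_inj m0 c0; pose w : 'rV[R]_N := \row_i (a * (m i)%:R).
pose b : 'cV[R]_N := \col_i Num.sqrt (c i).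
have b0 i : b i 0 != 0 by rewrite mxE gt_eqF// sqrtr_gt0.
have NN0 : (0 < N + N)%N by rewrite addn_gt0 N0.
exists (LosslessSystem NN0 (bank_J_skew w) (bank_controllable a0 m_inj m0 b0)) => t.
rewrite /impulse_response/= bank_impulse_response; apply: eq_bigr => i _.
by rewrite !mxE sqr_sqrtr// ltW.
Qed.

(** * Positive kernels made of cosines *)

Section OddCosineSums.
Context {R : realType}.
Implicit Types (f : R -> R) (n : nat).

(** Only odd multiples are allowed, so that the frequency 0, which is not that
of an oscillator, is excluded. *)
Definition odd_cosine_sum n f := exists2 v : 'I_n -> R, (forall k, 0 <= v k) &
  forall y, f y = \sum_k v k * cos (k.*2.+1%:R * y).

Lemma odd_cosine_sumD n f1 f2 : odd_cosine_sum n f1 -> odd_cosine_sum n f2 ->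
  odd_cosine_sum n (fun y => f1 y + f2 y).
Proof.
move=> [v1 v10 f1E] [v2 v20 f2E]; exists (fun k => v1 k + v2 k) => [k|y].
  exact: addr_ge0.
by rewrite f1E f2E -big_split/=; apply: eq_bigr => k _; rewrite mulrDl.
Qed.

Lemma odd_cosine_sumZ n c f : 0 <= c -> odd_cosine_sum n f ->
  odd_cosine_sum n (fun y => c * f y).
Proof.
move=> c0 [v v0 fE]; exists (fun k => c * v k) => [k|y]; first exact: mulr_ge0.
by rewrite fE mulr_sumr; apply: eq_bigr => k _; rewrite mulrA.
Qed.

Lemma odd_cosine_sum_cos n k : (k < n)%N ->
  odd_cosine_sum n (fun y => cos (k.*2.+1%:R * y)).
Proof.
move=> kn; exists (fun i => (i == Ordinal kn)%:R) => [i|y]; first exact: ler0n.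
rewrite (bigD1 (Ordinal kn))//= eqxx mul1r big1 ?addr0// => i /negPf ->.
by rewrite mul0r.
Qed.

Lemma odd_cosine_sum_big n m (f : 'I_m -> R -> R) :
  (forall i, odd_cosine_sum n (f i)) -> odd_cosine_sum n (fun y => \sum_i f i y).
Proof.
move=> cf; rewrite (_ : (fun y => _) = \sum_i f i); last by rewrite fct_sumE.
apply: (big_ind (odd_cosine_sum n)) => //.
- by exists (fun=> 0) => // y; rewrite big1// => k _; rewrite mul0r.
- by move=> f1 f2; exact: odd_cosine_sumD.
Qed.

(** For k = 0 the truncated predecessor is correct: the term of frequency -1
is that of frequency 1. *)
Lemma cos_sqr_mul_odd_cos (k : nat) (y : R) :
  cos y ^+ 2 * cos (k.*2.+1%:R * y) =
  2^-1 * cos (k.*2.+1%:R * y) + 4^-1 * cos (k.+1.*2.+1%:R * y) +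
    4^-1 * cos (k.-1.*2.+1%:R * y).
Proof.
have step j : j.+1.*2.+1%:R = j.*2.+1%:R + 2 :> R by rewrite doubleS -addn2 natrD.
have prev : cos (k.-1.*2.+1%:R * y) = cos (k.*2.+1%:R * y - y *+ 2).
  case: k => [|k] /=.
    by rewrite -[LHS]cosN; congr cos; rewrite double0; ring.
  by congr cos; rewrite step; move: (k.*2.+1%:R) => c; ring.
rewrite prev (_ : k.+1.*2.+1%:R * y = k.*2.+1%:R * y + y *+ 2); last first.
  by rewrite step; move: (k.*2.+1%:R) => c; ring.
by rewrite cosD cosB cos_mulr2n; field.
Qed.

(** Multiplication by cos^2 preserves nonnegative coefficients, by
[cos_sqr_mul_odd_cos], and raises the top frequency by one step. *)
Lemma odd_cosine_sum_expr N : odd_cosine_sum N.+1 (fun y => cos y ^+ N.*2.+1).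
Proof.
elim: N => [|N [v v0 vE]].
  have := @odd_cosine_sum_cos 1 0 isT; congr odd_cosine_sum.
  by apply/funext => y; rewrite mul1r expr1.
rewrite (_ : (fun y => _) = fun y => \sum_(k < N.+1) v k *
  (2^-1 * cos (k.*2.+1%:R * y) + 4^-1 * cos (k.+1.*2.+1%:R * y) +
    4^-1 * cos (k.-1.*2.+1%:R * y))); last first.
  apply/funext => y; rewrite doubleS !exprS mulrA -expr2 -exprS vE mulr_sumr.
  by apply: eq_bigr => k _; rewrite -cos_sqr_mul_odd_cos; ring.
apply: odd_cosine_sum_big => k; apply: odd_cosine_sumZ => //.
have kN := ltn_ord k.
apply: odd_cosine_sumD; [apply: odd_cosine_sumD|];
  apply: odd_cosine_sumZ; rewrite ?invr_ge0 ?ler0n//; apply: odd_cosine_sum_cos => //.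
- exact: ltnW.
- by rewrite ltnS (leq_trans (leq_pred _))// ltnW.
Qed.

End OddCosineSums.

Section EvenKernel.
Context {R : realType}.
Notation mu := (@lebesgue_measure R).
Variables (K Phi : R -> R) (T : R).
Hypotheses (T_gt0 : 0 < T) (dPhi : forall y, is_derive y (1 : R) Phi (K y)).
Hypotheses (K_even : forall y, K (- y) = K y) (Phi_odd : forall y, Phi (- y) = - Phi y).
Hypothesis K_cont : continuous K.
Hypothesis K_ge0 : forall y, 0 <= y <= T *+ 2 -> 0 <= K y.
Hypothesis K_dec : forall y z, 0 <= y -> y <= z -> z <= T *+ 2 -> K z <= K y.

Lemma kernel_primitive_itv y z : 0 <= y -> y <= z -> z <= T *+ 2 ->
  K z * (z - y) <= Phi z - Phi y <= K y * (z - y).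
Proof.
move=> y0 yz zT.
have cPhi : {within `[y, z], continuous Phi}.
  apply: continuous_subspaceT => s; exact: is_derive1_continuous (dPhi s).
have [c] := MVT_segment yz (fun s _ => dPhi s) cPhi.
rewrite in_itv/= => /andP[yc cz] ->.
by rewrite !ler_wpM2r ?subr_ge0// K_dec// ?(le_trans y0) ?(le_trans cz).
Qed.

(** The integrand is the convolution of the even extension of h with K, folded
on [0, T]; thanks to the folding there is no boundary layer at x = 0.  The total
mass of r |-> K (r - x) + K (r + x) on [0, T] is Phi (T - x) + Phi (T + x), which
falls short of 2 Phi (2T) by at most 4 T K(d).  On this mass h r is replaced by
h x, at the price of e where r is near x and of 2B where it is far, where
moreover the folded kernel is at most 2 K(d). *)
Lemma even_kernel_approx (h : R -> R) (x d e B : R) : continuous h ->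
  0 <= x -> 0 < d -> d <= T - x -> 0 <= e ->
  (forall r, 0 <= r <= T -> `|h r| <= B) ->
  (forall r, 0 <= r <= T -> `|r - x| < d -> `|h r - h x| <= e) ->
  `|h x * (Phi (T *+ 2) *+ 2) -
    \int[mu]_(r in `[0, T]) (h r * (K (r - x) + K (r + x)))|
  <= e * (Phi (T *+ 2) *+ 2) + 8 * B * T * K d.
Proof.
move=> ch x0 d0 dTx e0 hB he.
pose P r := K (r - x) + K (r + x).
have T0 := ltW T_gt0.
have xT : x <= T by rewrite -subr_ge0 (le_trans _ dTx)// ltW.
have B0 : 0 <= B by apply: le_trans (hB 0 _); rewrite ?lexx.
have Kd0 : 0 <= K d by apply: K_ge0; rewrite ltW//= mulr2n; lra.
have K_abs y : K `|y| = K y by case: (ger0P y) => // _; exact: K_even.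
have cP : continuous P.
  by move=> r; apply: cvgD; exact: continuous_translate.
have P_ge0 r : 0 <= r <= T -> 0 <= P r.
  move=> /andP[r0 rT]; apply: addr_ge0; last by apply: K_ge0; rewrite mulr2n; lra.
  rewrite -K_abs; apply: K_ge0; rewrite normr_ge0/= ler_norml mulr2n; lra.
have P_far r : 0 <= r <= T -> d <= `|r - x| -> P r <= K d *+ 2.
  move=> /andP[r0 rT] dr; rewrite mulr2n; apply: lerD.
    rewrite -K_abs; apply: K_dec => //; first exact: ltW.
    by rewrite ler_norml mulr2n; lra.
  apply: K_dec; [exact: ltW| |by rewrite mulr2n; lra].
  by apply: le_trans dr _; rewrite ler_norml; lra.
have mass : \int[mu]_(r in `[0, T]) P r = Phi (T - x) + Phi (T + x).
  rewrite (Rintegral_is_derive T0 (fun r _ => cP r)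
    (fun r _ => is_derive1D (is_derive1_translate (dPhi (r - x)))
      (is_derive1_translate (dPhi (r + x))))).
  by rewrite sub0r add0r Phi_odd addNr subr0.
have Phi2T y : 0 <= y <= T *+ 2 -> Phi y <= Phi (T *+ 2).
  move=> /andP[y0 yT]; have /andP[H _] := kernel_primitive_itv y0 yT (lexx _).
  rewrite -subr_ge0 (le_trans _ H)// mulr_ge0 ?subr_ge0// K_ge0// lexx andbT.
  exact: le_trans yT.
have Phi_gap y : d <= y <= T *+ 2 -> Phi (T *+ 2) - Phi y <= K d * (T *+ 2).
  move=> /andP[dy yT]; have y0 : 0 <= y by rewrite (le_trans _ dy)// ltW.
  have /andP[_ /le_trans] := kernel_primitive_itv y0 yT (lexx _); apply.
  apply: ler_pM.
  - by apply: K_ge0; rewrite y0.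
  - by rewrite subr_ge0.
  - by apply: K_dec => //; exact: ltW.
  - by rewrite lerBlDr lerDl.
have massle : Phi (T - x) + Phi (T + x) <= Phi (T *+ 2) *+ 2.
  by rewrite [leRHS]mulr2n lerD// Phi2T// mulr2n; lra.
have gap : Phi (T *+ 2) *+ 2 - (Phi (T - x) + Phi (T + x)) <= 4 * T * K d.
  have g1 : Phi (T *+ 2) - Phi (T - x) <= K d * (T *+ 2).
    by apply: Phi_gap; rewrite mulr2n; lra.
  have g2 : Phi (T *+ 2) - Phi (T + x) <= K d * (T *+ 2).
    by apply: Phi_gap; rewrite mulr2n; lra.
  move: g1 g2; rewrite !mulr2n; lra.
have iP : mu.-integrable `[0, T] (EFin \o P) by exact: continuous_integrable_segment.
have chP : continuous (fun r => h r * P r).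
  by move=> r; apply: cvgM; [exact: ch|exact: cP].
have cdiff : continuous (fun r => h x * P r - h r * P r).
  by move=> r; apply: cvgB; [apply: cvgMl_tmp; exact: cP|exact: chP].
have int_diff : \int[mu]_(r in `[0, T]) (h x * P r - h r * P r) =
    h x * (Phi (T - x) + Phi (T + x)) - \int[mu]_(r in `[0, T]) (h r * P r).
  rewrite RintegralB//.
  - by rewrite RintegralZl// mass.
  - apply: continuous_integrable_segment => r; apply: cvgMl_tmp; exact: cP.
  - exact: continuous_integrable_segment.
have diff_le : `|\int[mu]_(r in `[0, T]) (h x * P r - h r * P r)| <=
    e * (Phi (T - x) + Phi (T + x)) + 4 * B * K d * T.
  apply: le_trans (le_normr_Rintegral _ _) _ => //.
    exact: continuous_integrable_segment.
  rewrite (_ : _ + _ = \int[mu]_(r in `[0, T]) (e * P r + 4 * B * K d)); last first.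
    rewrite RintegralD//.
    - rewrite RintegralZl// mass Rintegral_cst//=.
      by rewrite lebesgue_measure_itv/= lte_fin T_gt0 oppr0 addr0.
    - apply: continuous_integrable_segment => r; apply: cvgMl_tmp; exact: cP.
    - by apply: continuous_integrable_segment => r; exact: cvg_cst.
  apply: le_Rintegral => //.
  - apply: continuous_integrable_segment => r; apply: cvg_norm; exact: cdiff.
  - apply: continuous_integrable_segment => r; apply: cvgD; last exact: cvg_cst.
    by apply: cvgMl_tmp; exact: cP.
  move=> r /=; rewrite in_itv/= => rT.
  rewrite -mulrBl normrM (ger0_norm (P_ge0 _ rT)) distrC.
  have [near|far] := ltP `|r - x| d.
    apply: (@le_trans _ _ (e * P r)).
      by rewrite ler_wpM2r ?P_ge0// he.
    by rewrite lerDl !mulr_ge0.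
  apply: (@le_trans _ _ (4 * B * K d)); last by rewrite lerDr mulr_ge0// P_ge0.
  have h2B : `|h r - h x| <= 2 * B.
    apply: (le_trans (ler_normB _ _)); rewrite mulr_natl mulr2n lerD// hB//.
    by rewrite x0 xT.
  apply: (le_trans (ler_pM _ _ h2B (P_far _ rT far))) => //; first exact: P_ge0.
  by rewrite mulr2n; lra.
rewrite (_ : _ - _ = (\int[mu]_(r in `[0, T]) (h x * P r - h r * P r)) +
  h x * (Phi (T *+ 2) *+ 2 - (Phi (T - x) + Phi (T + x)))); last first.
  by rewrite int_diff; ring.
apply: (le_trans (ler_normD _ _)).
apply: (@le_trans _ _ ((e * (Phi (T - x) + Phi (T + x)) + 4 * B * K d * T) + B * (4 * T * K d))).
  apply: lerD => //; rewrite normrM; apply: ler_pM => //.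
    by apply: hB; rewrite x0.
  by rewrite ger0_norm// subr_ge0.
have : e * (Phi (T - x) + Phi (T + x)) <= e * (Phi (T *+ 2) *+ 2) by rewrite ler_wpM2l.
lra.
Qed.

End EvenKernel.

Section CosineApproximation.
Context {R : realType}.
Notation mu := (@lebesgue_measure R).

Lemma le_cos_pihalf (y z : R) : 0 <= y -> y <= z -> z <= pi / 2 -> cos z <= cos y.
Proof.
move=> y0; rewrite le_eqVlt => /predU1P[-> //|yz zpi]; have pi0 := pi_ge0 R.
by apply: ltW; rewrite ltr_cos// in_itv/=; apply/andP; split; lra.
Qed.

Lemma exprn_small (q M e : R) : 0 <= q < 1 -> 0 < e ->
  exists N, M * q ^+ N <= e.
Proof.
move=> /andP[q0 q1] e0.
have : (fun n => M * q ^+ n) @ \oo --> M * 0.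
  by apply: cvgMl_tmp; apply: cvg_expr; rewrite ger0_norm.
rewrite mulr0 => /cvgrPdist_le /(_ _ e0) /filter_ex [N]; rewrite sub0r normrN => H.
by exists N; exact: le_trans (ler_norm _) H.
Qed.

(** With K(y) = cos(a y)^(2N+1), the integral of h(r) (K(r - x) + K(r + x)) is a
sum of multiples of cos(w_k x) whose coefficients carry the integrals of
h(r) cos(w_k r); this is where their sign is used.  The kernel concentrates at 0
because K(d) / K(d/2) = q^(2N+1) with q < 1, while the total mass of K is at
least d K(d/2). *)
Lemma odd_cosine_approx (h : R -> R) (T tau eps : R) : continuous h ->
  (forall e : R, 0 < e -> exists2 d : R, 0 < d & forall r x,
     0 <= r <= T -> 0 <= x <= T -> `|r - x| < d -> `|h r - h x| <= e) ->
  (forall v, 0 <= \int[mu]_(r in `[0, T]) (h r * cos (v * r))) ->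
  0 <= tau -> tau < T -> 0 < eps ->
  exists N (a : R) (c : 'I_N.+1 -> R), [/\ 0 < a, forall k, 0 <= c k &
    forall x, 0 <= x <= tau ->
      `|h x - \sum_k c k * cos (a * k.*2.+1%:R * x)| <= eps].
Proof.
move=> ch uch hpos tau0 tauT eps0.
have T_gt0 : 0 < T by exact: le_lt_trans tauT.
have T0 := ltW T_gt0.
have eps20 : 0 < eps / 2 by rewrite divr_gt0.
have pi_gt0 := pi_gt0 R.
(* so that a y stays in [- pi/2, pi/2], where cos is even, nonnegative and
   decreasing in |y|, for all y in [-2T, 2T] *)
pose a : R := pi / (T *+ 4).
have a_gt0 : 0 < a by rewrite divr_gt0// pmulrn_lgt0.
have aT2 : a * (T *+ 2) = pi / 2.
  by rewrite /a -[T *+ 4]mulr_natr -[T *+ 2]mulr_natr; field; rewrite gt_eqF.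
have [B B0 hB] := continuous_bounded_segment T0 ch.
have [d0 d00 hd0] := uch _ eps20.
(* the cap T - tau keeps [x - d, x + d] on the left of T for all x <= tau *)
pose d := Num.min d0 (T - tau).
have d_gt0 : 0 < d by rewrite lt_min d00 subr_gt0.
have dTtau : d <= T - tau by rewrite ge_min lexx orbT.
have dT : d <= T by rewrite (le_trans dTtau)// lerBlDr lerDl.
have ad_le : a * d <= pi / 4.
  apply: (@le_trans _ _ (a * T)); first by rewrite ler_wpM2l// ltW.
  by move: aT2; rewrite -[T *+ 2]mulr_natr; lra.
have ad0 : 0 < a * d by exact: mulr_gt0.
have cosd2 : 0 < cos (a * (d / 2)) by apply: cos_gt0_pihalf; lra.
pose q := cos (a * d) / cos (a * (d / 2)).
have q01 : 0 <= q < 1.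
  rewrite divr_ge0 ?ltW//=; last by apply: cos_gt0_pihalf; lra.
  by rewrite ltr_pdivrMr// mul1r ltr_cos ?in_itv/=; lra.
have [N qN] := exprn_small (8 * B * T / d) q01 eps20.
have [v v0 vE] := @odd_cosine_sum_expr R N.
pose w (k : 'I_N.+1) : R := a * k.*2.+1%:R.
have w_gt0 k : 0 < w k by rewrite mulr_gt0.
pose K y := cos (a * y) ^+ N.*2.+1.
have KE y : K y = \sum_k v k * cos (w k * y).
  by rewrite /K vE; apply: eq_bigr => k _; rewrite /w mulrCA mulrA.
pose Phi y := \sum_k v k / w k * sin (w k * y).
have dPhi y : is_derive y (1 : R) Phi (K y).
  rewrite KE; apply: is_derive1_sum => k.
  apply: (is_derive_eq (is_derive1Z _ (is_derive1_sinM (w k) y))).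
  by rewrite mulrA divfK// gt_eqF.
have K_even y : K (- y) = K y by rewrite /K mulrN cosN.
have Phi_odd y : Phi (- y) = - Phi y.
  by rewrite /Phi -sumrN; apply: eq_bigr => k _; rewrite mulrN sinN mulrN.
have K_cont : continuous K.
  rewrite (_ : K = fun y => \sum_k v k * cos (w k * y)); last exact/funext.
  move=> y; apply: cvg_sumr => k _; apply: cvgMl_tmp.
  exact: is_derive1_continuous (is_derive1_cosM _ _).
have a_itv y : 0 <= y <= T *+ 2 -> 0 <= a * y <= pi / 2.
  move=> /andP[y0 yT]; apply/andP; split; first exact/mulr_ge0/y0/ltW.
  by rewrite -aT2 ler_wpM2l// ltW.
have K_ge0 y : 0 <= y <= T *+ 2 -> 0 <= K y.
  move=> /a_itv yT; apply/exprn_ge0/cos_ge0_pihalf; lra.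
have K_dec y z : 0 <= y -> y <= z -> z <= T *+ 2 -> K z <= K y.
  move=> y0 yz zT; apply: lerXn2r; rewrite ?nnegrE.
  - by apply: cos_ge0_pihalf; have := a_itv z; rewrite (le_trans y0 yz) zT => /(_ isT); lra.
  - by apply: cos_ge0_pihalf; have := a_itv y; rewrite y0 (le_trans yz zT) => /(_ isT); lra.
  - apply: le_cos_pihalf; [exact/mulr_ge0/y0/ltW|by rewrite ler_wpM2l// ltW|].
    by rewrite -aT2 ler_wpM2l// ltW.
have Phi0 : Phi 0 = 0 by rewrite /Phi big1// => k _; rewrite mulr0 sin0 mulr0.
pose C := Phi (T *+ 2) *+ 2.
have Kd2_gt0 : 0 < K (d / 2) by exact: exprn_gt0.
have C_ge : d * K (d / 2) <= C.
  have itv := kernel_primitive_itv dPhi K_dec.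
  have d2T : d / 2 <= T *+ 2 by rewrite -[T *+ 2]mulr_natr; lra.
  have d20 : 0 <= d / 2 by lra.
  have /andP[l1 _] := itv 0 (d / 2) (lexx _) d20 d2T.
  have /andP[l2 _] := itv (d / 2) (T *+ 2) d20 d2T (lexx _).
  have : 0 <= K (T *+ 2) * (T *+ 2 - d / 2).
    by rewrite mulr_ge0 ?subr_ge0// K_ge0// lexx mulrn_wge0.
  move: l1 l2; rewrite Phi0 /C -[Phi _ *+ 2]mulr_natr; lra.
have C_gt0 : 0 < C by apply: lt_le_trans C_ge; exact: mulr_gt0.
have Kd_le : 8 * B * T * K d <= eps / 2 * C.
  have -> : K d = q ^+ N.*2.+1 * K (d / 2).
    by rewrite /K /q -exprMn divfK// gt_eqF.
  apply: le_trans (_ : eps / 2 * (d * K (d / 2)) <= _); last by rewrite ler_wpM2l// ltW.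
  rewrite mulrA [in leRHS]mulrA (ler_wpM2r (ltW Kd2_gt0))//.
  rewrite -ler_pdivrMr// mulrAC.
  apply: le_trans qN; rewrite ler_wpM2l//.
    by rewrite !mulr_ge0// invr_ge0 ltW.
  case/andP: q01 => q0 q1.
  by apply: ler_wiXn2l => //; [exact: ltW|rewrite -addnn -addnS leq_addr].
exists N, a, (fun k => 2 * v k * (\int[mu]_(r in `[0, T]) (h r * cos (w k * r))) / C).
split => // [k|x /andP[x0 xtau]].
  by apply: mulr_ge0; [rewrite !mulr_ge0|rewrite invr_ge0 ltW].
have xT : 0 <= x <= T by rewrite x0 (le_trans xtau)// ltW.
have hd r : 0 <= r <= T -> `|r - x| < d -> `|h r - h x| <= eps / 2.
  by move=> rT rx; apply: hd0 => //; apply: lt_le_trans rx _; rewrite ge_min lexx.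
have dTx : d <= T - x by rewrite (le_trans dTtau)// lerD2l lerN2.
have := even_kernel_approx T_gt0 dPhi K_even Phi_odd K_cont K_ge0 K_dec ch x0 d_gt0
  dTx (ltW eps20) hB hd.
rewrite (_ : (\int[mu]_(r in `[0, T]) _) = C * \sum_k
    2 * v k * (\int[mu]_(r in `[0, T]) (h r * cos (w k * r))) / C * cos (a * k.*2.+1%:R * x));
    last first.
  have ihcos k : mu.-integrable `[0, T] (EFin \o (fun r => h r * cos (w k * r))).
    apply: continuous_integrable_segment => r; apply: cvgM; first exact: ch.
    exact: is_derive1_continuous (is_derive1_cosM _ _).
  rewrite (_ : (fun r => _) = (fun r => \sum_k
      (2 * v k * cos (w k * x)) * (h r * cos (w k * r)))); last first.
    apply/funext => r; rewrite !KE -big_split/= mulr_sumr; apply: eq_bigr => k _.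
    by rewrite (mulrBr (w k)) (mulrDr (w k)) cosB cosD; ring.
  rewrite Rintegral_segment_sum//; last first.
    move=> k; apply: continuous_integrable_segment => r; apply: cvgMl_tmp.
    apply: cvgM; first exact: ch.
    exact: is_derive1_continuous (is_derive1_cosM _ _).
  rewrite mulr_sumr; apply: eq_bigr => k _; rewrite RintegralZl//.
  rewrite [a * _](_ : _ = w k)//; move: (cos (w k * x)) (Rintegral _ _ _) => c I.
  by move: (C) C_gt0 (v k) => C0 C0_gt0 vk; field; rewrite gt_eqF.
rewrite -/C mulrC -mulrBr normrM (gtr0_norm C_gt0) => H.
rewrite -(ler_pM2l C_gt0) (le_trans H)//.
by rewrite (_ : C * eps = eps / 2 * C + eps / 2 * C) ?lerD2l// -mulrDl -splitr mulrC.
Qed.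

End CosineApproximation.

(** * Dissipative systems are limits of lossless ones *)

Section ContinuousExtension.
Context {R : realType}.
Variable g : R -> R.
Hypothesis g_ac : forall b : R, 0 < b -> abs_continuous_on 0 b g.

(** The response g is arbitrary on negative times; freezing it there at g 0
makes it continuous on the whole line. *)
Definition extend_left (t : R) : R := g (Num.max 0 t).

Lemma extend_leftE t : 0 <= t -> extend_left t = g t.
Proof. by rewrite /extend_left => t0; rewrite max_r. Qed.

Lemma abs_continuous_uniform (b e : R) : 0 < b -> 0 < e ->
  exists2 d : R, 0 < d & forall r x, 0 <= r <= b -> 0 <= x <= b ->
    `|r - x| < d -> `|g r - g x| < e.
Proof.
move=> b0 e0; have [d d0 H] := g_ac b0 e0; exists d => //.
suff wl r x : r <= x -> 0 <= r <= b -> 0 <= x <= b -> `|r - x| < d -> `|g x - g r| < e.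
  move=> r x rb xb rx; have [le_rx|/ltW le_xr] := leP r x.
    by rewrite distrC; exact: wl.
  by apply: wl => //; rewrite distrC.
move=> rx /andP[r0 _] /andP[_ xb] rxd.
have := H 1%N (fun=> r) (fun=> x); rewrite !big_ord1; apply => //.
- by apply/trivIsetP => i j _ _; rewrite !ord1 eqxx.
- by rewrite -(ger0_norm (_ : 0 <= x - r)) ?subr_ge0// distrC.
Qed.

Lemma continuous_extend_left : continuous extend_left.
Proof.
move=> t; apply/cvgrPdist_lt => e e0.
pose b : R := `|t| + 1.
have b0 : 0 < b by rewrite ltr_wpDl.
have [d d0 H] := abs_continuous_uniform b0 e0.
have m0 (s : R) : s <= b -> 0 <= Num.max 0 s <= b.
  by move=> sb; rewrite le_max lexx/= ge_max sb ltW.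
near=> s; apply: H.
- by apply: m0; rewrite /b (le_trans (ler_norm t))// lerDl.
- have st : `|t - s| < 1 by near: s; exact: cvgr_dist_lt.
  by apply: m0; move: st (ler_norm t); rewrite ltr_norml /b => /andP[? ?] ?; lra.
- have : `|t - s| < d by near: s; exact: cvgr_dist_lt.
  apply: le_lt_trans; rewrite ler_norml; have := ler_norm (t - s).
  have := ler_norm (s - t); rewrite distrC.
  by case: (leP 0 s); case: (leP 0 t) => *; lra.
Unshelve. all: by end_near. Qed.

End ContinuousExtension.

Section Dissipative.
Context {R : realType}.
Notation mu := (@lebesgue_measure R).
Variables (g G : R -> R).
Hypotheses (G_cont : continuous G) (GE : forall t : R, 0 <= t -> G t = g t).

(** Write cos(w s) = cos(w t - w (t - s)), expand, and integrate in r = t - s. *)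
Lemma response_sinusoid (Fc Fs : R -> R) (w t : R) : 0 <= t ->
  Fc 0 = 0 -> Fs 0 = 0 ->
  (forall s : R, (-1 < s)%R -> is_derive s (1 : R) Fc (G s * cos (w * s))) ->
  (forall s : R, (-1 < s)%R -> is_derive s (1 : R) Fs (G s * sin (w * s))) ->
  response g (fun s => cos (w * s)) t = cos (w * t) * Fc t + sin (w * t) * Fs t /\
  response g (fun s => sin (w * s)) t = sin (w * t) * Fc t - cos (w * t) * Fs t.
Proof.
move=> t0 Fc0 Fs0 dFc dFs.
have ts1 s : 0 <= s <= t -> -1 < t - s by move=> /andP[? ?]; lra.
have cGr : continuous (fun s => G (t - s)) by exact: continuous_reflect.
have gG u : response g u t = \int[mu]_(s in `[0, t]) (G (t - s) * u s).
  apply: eq_Rintegral => s; rewrite inE/= in_itv/= => /andP[_ st].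
  by rewrite GE// subr_ge0.
have wts (s : R) : w * s = w * t - w * (t - s) by ring.
rewrite !gG; split.
- have dF (s : R) : 0 <= s <= t -> is_derive s (1 : R)
      (fun s => - cos (w * t) * Fc (t - s) - sin (w * t) * Fs (t - s))
      (G (t - s) * cos (w * s)).
    move=> st; apply: (is_derive_eq (is_derive1B
      (is_derive1Z _ (is_derive1_reflect (dFc _ (ts1 _ st))))
      (is_derive1Z _ (is_derive1_reflect (dFs _ (ts1 _ st)))))).
    by rewrite (wts s) cosB; ring.
  rewrite (Rintegral_is_derive t0 _ dF).
    by rewrite subrr subr0 Fc0 Fs0 !mulr0 subrr sub0r mulNr; ring.
  move=> s _; apply: cvgM; first exact: cGr.
  exact: is_derive1_continuous (is_derive1_cosM _ _).
- have dF (s : R) : 0 <= s <= t -> is_derive s (1 : R)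
      (fun s => - sin (w * t) * Fc (t - s) + cos (w * t) * Fs (t - s))
      (G (t - s) * sin (w * s)).
    move=> st; apply: (is_derive_eq (is_derive1D
      (is_derive1Z _ (is_derive1_reflect (dFc _ (ts1 _ st))))
      (is_derive1Z _ (is_derive1_reflect (dFs _ (ts1 _ st)))))).
    by rewrite (wts s) sinB; ring.
  rewrite (Rintegral_is_derive t0 _ dF).
    by rewrite subrr subr0 Fc0 Fs0 !mulr0 addr0 sub0r mulNr; ring.
  move=> s _; apply: cvgM; first exact: cGr.
  exact: is_derive1_continuous (is_derive1_sinM _ _).
Qed.

(** The works of cos(w t) and of sin(w t) add up to the integral over [0, T] of
Fc(t), the integral of G(r) cos(w r) for r in [0, t]; integration by parts turns
it into a single integral with the weight T - r. *)
Lemma dissipative_cosine_ge0 (T w : R) : dissipative g -> 0 <= T ->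
  0 <= \int[mu]_(r in `[0, T]) ((T - r) * (G r * cos (w * r))).
Proof.
move=> dg T0.
have ccos : continuous (fun t : R => cos (w * t)).
  by move=> t; exact: is_derive1_continuous (is_derive1_cosM _ _).
have csin : continuous (fun t : R => sin (w * t)).
  by move=> t; exact: is_derive1_continuous (is_derive1_sinM _ _).
have cGc : continuous (fun t => G t * cos (w * t)).
  by move=> t; apply: cvgM; [exact: G_cont|exact: ccos].
have cGs : continuous (fun t => G t * sin (w * t)).
  by move=> t; apply: cvgM; [exact: G_cont|exact: csin].
have [Fc Fc0 dFc] := exists_primitive cGc.
have [Fs Fs0 dFs] := exists_primitive cGs.
have resp (t : R) (t0 : 0 <= t) := response_sinusoid t0 Fc0 Fs0 dFc dFs.
have N1 t : 0 <= t <= T -> -1 < t by move=> /andP[? _]; lra.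
have cFc (t : R) : 0 <= t <= T -> {for t, continuous Fc}.
  by move=> /N1/dFc; exact: is_derive1_continuous.
have cFs (t : R) : 0 <= t <= T -> {for t, continuous Fs}.
  by move=> /N1/dFs; exact: is_derive1_continuous.
have int_on (f : R -> R) : (forall t, 0 <= t <= T -> {for t, continuous f}) ->
    mu.-integrable `[0, T] (EFin \o f).
  move=> cf; apply: integrable_segment; apply: continuous_in_subspaceT => t.
  by rewrite inE/= in_itv/= => /cf.
have work_c : \int[mu]_(t in `[0, T]) (response g (fun s => cos (w * s)) t * cos (w * t)) =
    \int[mu]_(t in `[0, T]) ((cos (w * t) * Fc t + sin (w * t) * Fs t) * cos (w * t)).
  by apply: eq_Rintegral => t; rewrite inE/= in_itv/= => /andP[/resp[-> _]].
have work_s : \int[mu]_(t in `[0, T]) (response g (fun s => sin (w * s)) t * sin (w * t)) =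
    \int[mu]_(t in `[0, T]) ((sin (w * t) * Fc t - cos (w * t) * Fs t) * sin (w * t)).
  by apply: eq_Rintegral => t; rewrite inE/= in_itv/= => /andP[/resp[_ ->]].
have : 0 <= \int[mu]_(t in `[0, T]) Fc t.
  rewrite (_ : \int[mu]_(t in `[0, T]) Fc t =
    \int[mu]_(t in `[0, T]) (response g (fun s => cos (w * s)) t * cos (w * t)) +
    \int[mu]_(t in `[0, T]) (response g (fun s => sin (w * s)) t * sin (w * t))).
    by apply: addr_ge0; apply: dg => //; exact: continuous_admissible.
  rewrite work_c work_s -RintegralD//.
  - apply: eq_Rintegral => t _; have := cos2Dsin2 (w * t).
    move: (cos _) (sin _) => c s cs.
    transitivity ((c ^+ 2 + s ^+ 2) * Fc t); first by rewrite cs mul1r.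
    by ring.
  - apply: int_on => t tT; apply: cvgM; last exact: ccos.
    by apply: cvgD; apply: cvgM; [exact: ccos|exact: cFc|exact: csin|exact: cFs].
  - apply: int_on => t tT; apply: cvgM; last exact: csin.
    by apply: cvgB; apply: cvgM; [exact: csin|exact: cFc|exact: ccos|exact: cFs].
have cTr : continuous (fun t : R => T - t).
  by move=> t; apply: cvgB; [exact: cvg_cst|exact: cvg_id].
have cTG : continuous (fun t => (T - t) * (G t * cos (w * t))).
  by move=> t; apply: cvgM; [exact: cTr|exact: cGc].
have dF (t : R) : 0 <= t <= T -> is_derive t (1 : R) (fun t => (T - t) * Fc t)
    ((T - t) * (G t * cos (w * t)) - Fc t).
  move=> tT; apply: (is_derive_eq (is_derive1M
    (is_derive1B (is_derive_cst T t 1) (is_derive_id t 1)) (dFc _ (N1 _ tT)))).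
  by rewrite sub0r mulN1r addrC.
have cint (t : R) : 0 <= t <= T ->
    {for t, continuous (fun t => (T - t) * (G t * cos (w * t)) - Fc t)}.
  by move=> tT; apply: cvgB; [exact: cTG|exact: cFc].
have := Rintegral_is_derive T0 cint dF.
rewrite RintegralB//; last exact: int_on.
- by rewrite subrr mul0r Fc0 mulr0 subrr => /eqP; rewrite subr_eq0 => /eqP ->.
- exact: continuous_integrable_segment.
Qed.

End Dissipative.

Section LosslessApproximation.
Context {R : realType}.
Notation mu := (@lebesgue_measure R).

Lemma dissipative_taper_ge0 (g G : R -> R) (T w : R) : continuous G ->
    (forall t : R, 0 <= t -> G t = g t) -> dissipative g -> 0 < T ->
  0 <= \int[mu]_(r in `[0, T]) ((1 - r / T) * G r * cos (w * r)).
Proof.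
move=> cG GE dg T0.
have := dissipative_cosine_ge0 cG GE w dg (ltW T0).
rewrite (_ : \int[mu]_(r in `[0, T]) ((1 - r / T) * G r * cos (w * r)) =
  T^-1 * \int[mu]_(r in `[0, T]) ((T - r) * (G r * cos (w * r)))).
  by move=> H; rewrite mulr_ge0// invr_ge0 ltW.
rewrite -RintegralZl//.
  by apply: eq_Rintegral => r _; field; rewrite gt_eqF.
apply: continuous_integrable_segment => r; apply: cvgM.
  by apply: cvgB; [exact: cvg_cst|exact: cvg_id].
apply: cvgM; first exact: cG.
exact: is_derive1_continuous (is_derive1_cosM _ _).
Qed.

Lemma dissipative_uniform_approx (g : R -> R) (eps tau : R) :
    (forall b : R, 0 < b -> abs_continuous_on 0 b g) -> dissipative g ->
    0 < eps -> 0 < tau ->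
  exists S : lossless_system R, forall x, 0 <= x <= tau ->
    `|g x - impulse_response S x| <= eps.
Proof.
move=> g_ac dg eps0 tau0.
pose G := extend_left g.
have cG : continuous G by exact: continuous_extend_left.
have GE (t : R) : 0 <= t -> G t = g t by exact: extend_leftE.
have e30 : 0 < eps / 3 by rewrite divr_gt0.
have [M M0 hM] := continuous_bounded_segment (ltW tau0) cG.
(* the taper changes g by at most tau M / T <= eps / 3 on [0, tau] *)
pose T := tau + 1 + tau * M / (eps / 3).
have tM0 : 0 <= tau * M / (eps / 3) by rewrite !mulr_ge0 ?invr_ge0// ltW.
have tauT : tau < T by rewrite /T; lra.
have T0 : 0 < T by exact: lt_trans tauT.
have [B B0 hB] := continuous_bounded_segment (ltW T0) cG.
pose h r := (1 - r / T) * G r.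
have ch : continuous h.
  move=> r; apply: cvgM; last exact: cG.
  apply: cvgB; first exact: cvg_cst.
  by apply: cvgMr_tmp; exact: cvg_id.
have uch (e : R) : 0 < e -> exists2 d : R, 0 < d & forall r x,
    0 <= r <= T -> 0 <= x <= T -> `|r - x| < d -> `|h r - h x| <= e.
  move=> e0; have e20 : 0 < e / 2 by rewrite divr_gt0.
  have [d1 d10 hd1] := abs_continuous_uniform g_ac T0 e20.
  pose d2 := e / 2 * T / (B + 1).
  have d20 : 0 < d2 by rewrite !mulr_gt0// invr_gt0 ltr_wpDl.
  exists (Num.min d1 d2); first by rewrite lt_min d10.
  move=> r x rT xT; rewrite lt_min => /andP[rx1 rx2].
  rewrite /h (_ : _ - _ = (1 - r / T) * (G r - G x) + G x * ((x - r) / T)); last first.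
    by field; rewrite gt_eqF.
  rewrite [leRHS](splitr e) (le_trans (ler_normD _ _))// lerD//.
    rewrite normrM -[leRHS]mul1r ler_pM//.
      have : 0 <= r / T <= 1.
        by case/andP: rT => r0 rT; rewrite ler_pdivrMr// mul1r rT divr_ge0// ltW.
      by move=> /andP[? ?]; rewrite ler_norml; lra.
    case/andP: (rT) => r0 _; case/andP: (xT) => x0 _.
    by rewrite !GE// ltW// hd1.
  rewrite normrM normrM normfV (gtr0_norm T0) mulrA ler_pdivrMr// distrC.
  apply: (@le_trans _ _ ((B + 1) * d2)).
    by rewrite ler_pM// ?(ltW rx2)// (le_trans (hB _ xT))// lerDl.
  by rewrite /d2 mulrC divfK// gt_eqF// ltr_wpDl.
have hpos v : 0 <= \int[mu]_(r in `[0, T]) (h r * cos (v * r)).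
  exact: (dissipative_taper_ge0 v cG GE dg T0).
have [N [a [c [a0 c0 hc]]]] := odd_cosine_approx ch uch hpos (ltW tau0) tauT e30.
(* controllability needs positive gains, while some c k may vanish *)
pose dl : R := eps / 3 / N.+1%:R.
have dl0 : 0 < dl by rewrite divr_gt0.
have m_inj : injective (fun k : 'I_N.+1 => k.*2.+1).
  by move=> k l /= [] /double_inj/ord_inj.
have [S hS] := @exists_oscillator_bank R N.+1 a (fun k => k.*2.+1) (fun k => c k + dl)
  isT a0 m_inj (fun=> isT) (fun k => ltr_wpDl (c0 k) dl0).
exists S => x xtau; case/andP: (xtau) => x0 xle.
rewrite hS -GE//.
rewrite (_ : _ - _ = (G x - h x) +
  (h x - \sum_k c k * cos (a * k.*2.+1%:R * x)) -
  \sum_(k < N.+1) dl * cos (a * k.*2.+1%:R * x)); last first.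
  under eq_bigr do rewrite mulrDl.
  by rewrite big_split/=; ring.
rewrite (_ : eps = eps / 3 + eps / 3 + eps / 3); last by field.
apply: (le_trans (ler_normB _ _)); apply: lerD.
  apply: (le_trans (ler_normD _ _)); apply: lerD; last exact: hc.
  rewrite /h (_ : _ - _ = x / T * G x); last by ring.
  rewrite normrM (ger0_norm (divr_ge0 x0 (ltW T0))) mulrAC ler_pdivrMr//.
  apply: (@le_trans _ _ (tau * M)); first by rewrite ler_pM// hM.
  rewrite -ler_pdivrMl// mulrC /T; lra.
apply: (le_trans (ler_norm_sum _ _ _)).
apply: (@le_trans _ _ (\sum_(k < N.+1) dl)).
  apply: ler_sum => k _; rewrite normrM (gtr0_norm dl0) ler_piMr ?cos_max//.
  exact: ltW.
by rewrite sumr_const card_ord -[dl *+ _]mulr_natr /dl divfK.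
Qed.

End LosslessApproximation.

(** * Limits of lossless systems are dissipative *)

Section ProductKernels.
Context {R : realType}.
Notation mu := (@lebesgue_measure R).
Implicit Types (f : R -> R) (b : R * R -> bool).
Local Open Scope ereal_scope.

Lemma integrable_tensor (f1 f2 : R -> R) :
  mu.-integrable setT (EFin \o f1) -> mu.-integrable setT (EFin \o f2) ->
  (mu \x mu).-integrable setT (fun z => (f1 z.1 * f2 z.2)%:E).
Proof.
move=> if1 if2; have mf1 : measurable_fun setT f1 by apply/measurable_EFinP; case/integrableP: if1.
have mf2 : measurable_fun setT f2 by apply/measurable_EFinP; case/integrableP: if2.
apply/integrable12ltyP.
  apply/measurable_EFinP; apply: measurable_funM.
    exact: (measurableT_comp mf1 measurable_fst).
  exact: (measurableT_comp mf2 measurable_snd).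
have I2 : \int[mu]_y `|(f2 y)%:E| < +oo by case/integrableP: if2.
rewrite (_ : \int[mu]_x _ = (\int[mu]_y `|(f2 y)%:E|) * \int[mu]_x `|(f1 x)%:E|); last first.
  rewrite -ge0_integralZl//.
  - apply: eq_integral => x _ /=; under eq_integral do rewrite normrM EFinM.
    rewrite ge0_integralZl//.
    + by rewrite muleC.
    + by apply/measurable_EFinP; exact: measurableT_comp.
  - by apply/measurable_EFinP; exact: measurableT_comp.
  - exact: integral_ge0.
rewrite lte_mul_pinfty ?integral_ge0//; last by case/integrableP: if1.
by rewrite ge0_fin_numE ?integral_ge0.
Qed.

Lemma integrable_dominated_tensor (f1 f2 : R -> R) (C : R) (k : R * R -> R) :
  mu.-integrable setT (EFin \o f1) -> mu.-integrable setT (EFin \o f2) ->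
  measurable_fun setT k ->
  (forall z, `|k z| <= C * `|f1 z.1 * f2 z.2|)%R ->
  (mu \x mu).-integrable setT (EFin \o k).
Proof.
move=> if1 if2 mk kC.
apply: (le_integrable _ _ _ (integrableZl _ C (integrable_tensor if1 if2))) => //.
  exact/measurable_EFinP.
move=> z _ /=; rewrite lee_fin (le_trans (kC z))// (normrM C) ler_wpM2r//.
exact: ler_norm.
Qed.

Section RankOne.
Variable psi : R -> R.
Hypothesis ipsi : mu.-integrable setT (EFin \o psi).

Let ker b (z : R * R) : R := if b z then (psi z.1 * psi z.2)%R else 0%R.

Let iker b : measurable_fun setT b ->
  (mu \x mu).-integrable setT (EFin \o ker b).
Proof.
move=> mb; have mpsi : measurable_fun setT psi.
  by apply/measurable_EFinP; case/integrableP: ipsi.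
apply: (integrable_dominated_tensor (C := 1%R) ipsi ipsi).
  apply: measurable_fun_ifT => //; apply: measurable_funM.
    exact: (measurableT_comp mpsi measurable_fst).
  exact: (measurableT_comp mpsi measurable_snd).
by move=> z; rewrite mul1r /ker; case: (b z) => //; rewrite normr0.
Qed.

(** By Fubini and symmetry the triangles z.2 <= z.1 and z.1 < z.2 contribute
equally, the diagonal being negligible; together they give the square of the
integral of psi. *)
Lemma causal_rank_one_ge0 :
  0 <= \int[mu \x mu]_z
    (if (z.2 <= z.1)%R then (psi z.1 * psi z.2)%R else 0%R)%:E.
Proof.
pose le2 (z : R * R) := (z.2 <= z.1)%R; pose gt2 (z : R * R) := (z.1 < z.2)%R.
have ile : (mu \x mu).-integrable setT (EFin \o ker le2).
  by apply: iker; apply: measurable_fun_ler.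
have igt : (mu \x mu).-integrable setT (EFin \o ker gt2).
  by apply: iker; apply: measurable_fun_ltr.
have sym : \int[mu \x mu]_z (ker le2 z)%:E = \int[mu \x mu]_z (ker gt2 z)%:E.
  rewrite -(integral12_prod_meas1 ile) -(integral21_prod_meas1 igt).
  apply: eq_integral => x _; rewrite /fubini_F /fubini_G /=.
  transitivity (\int[mu]_(y in `]-oo, x]) (psi x * psi y)%:E).
    rewrite [RHS]integral_mkcond; apply: eq_integral => y _.
    by rewrite patchE /ker /le2 /= mem_setE in_itv/=; case: (y <= x)%R.
  rewrite -integral_itv_bndo_bndc; last first.
    apply/measurable_EFinP; apply: measurable_funM => //.
    by apply: measurable_funTS; apply/measurable_EFinP; case/integrableP: ipsi.
  rewrite integral_mkcond; apply: eq_integral => y _.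
  by rewrite patchE /ker /gt2 /= mem_setE in_itv/= mulrC; case: (y < x)%R.
have ipsi_fin : \int[mu]_x (psi x)%:E \is a fin_num by exact: integrable_fin_num.
have tensor : \int[mu \x mu]_z (psi z.1 * psi z.2)%:E =
    (\int[mu]_x (psi x)%:E) * (\int[mu]_x (psi x)%:E).
  rewrite -(integral12_prod_meas1 (integrable_tensor ipsi ipsi)) /fubini_F /=.
  under eq_integral => x _.
    under eq_integral do rewrite EFinM.
    rewrite integralZl//; over.
  rewrite -(fineK ipsi_fin) /=; under eq_integral do rewrite muleC.
  by rewrite integralZl// fineK.
have : 0 <= \int[mu \x mu]_z (ker le2 z)%:E + \int[mu \x mu]_z (ker gt2 z)%:E.
  rewrite -integralD//.
  rewrite (_ : \int[mu \x mu]_z _ = \int[mu \x mu]_z (psi z.1 * psi z.2)%:E).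
    by rewrite tensor -(fineK ipsi_fin) -EFinM lee_fin -expr2 sqr_ge0.
  apply: eq_integral => z _; rewrite /ker /le2 /gt2 /= -EFinD.
  by case: (leP z.2 z.1); rewrite ?addr0 ?add0r.
rewrite -sym; have fle := integrable_fin_num measurableT ile.
have -> : \int[mu \x mu]_z (if (z.2 <= z.1)%R then (psi z.1 * psi z.2)%R else 0%R)%:E =
  \int[mu \x mu]_z (ker le2 z)%:E by [].
rewrite -(fineK fle) -EFinD !lee_fin; lra.
Qed.

End RankOne.
End ProductKernels.

Section Work.
Context {R : realType}.
Notation mu := (@lebesgue_measure R).
Variables (T : R) (u : R -> R).
Hypotheses (T_gt0 : 0 < T) (u_adm : admissible T u).

Let v : R -> R := u \_ `[0, T].

Let vE t : 0 <= t <= T -> v t = u t.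
Proof. by move=> tT; rewrite /v patchE mem_setE in_itv/= tT. Qed.

Let v_out t : ~~ (0 <= t <= T) -> v t = 0.
Proof. by move=> tT; rewrite /v patchE mem_setE in_itv/= (negPf tT). Qed.

Let mv : measurable_fun setT v.
Proof. by move: u_adm; rewrite /admissible /in_Lp inE => /andP[]; rewrite inE. Qed.

Let iv2 : mu.-integrable setT (EFin \o (fun t => v t ^+ 2)).
Proof. exact: Lfun2_integrable_sqr. Qed.

Let iv : mu.-integrable setT (EFin \o v).
Proof.
(* on [0, T], |v| <= 1 + v^2 *)
pose c := (fun=> 1 : R) \_ `[0, T].
have ic : mu.-integrable setT (EFin \o c).
  rewrite /c -restrict_EFin; apply/(integrable_mkcond _ _).1 => //.
  by apply: continuous_integrable_segment => t; exact: cvg_cst.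
have i1 : mu.-integrable setT (EFin \o (fun t => c t + v t ^+ 2)).
  exact: (integrableD measurableT ic iv2).
apply: (le_integrable _ _ _ i1) => //; first exact/measurable_EFinP.
move=> t _ /=; rewrite lee_fin /c patchE mem_setE in_itv/=.
case: ifPn => [_|/v_out ->]; last by rewrite normr0.
rewrite [leRHS]ger0_norm ?addr_ge0 ?sqr_ge0//=.
rewrite -real_normK ?num_real//; have := sqr_ge0 (`|v t| - 1); have := normr_ge0 (v t).
nra.
Qed.

Definition work (q : R -> R) : R :=
  \int[mu]_(t in `[0, T]) (response q u t * u t).

(** The work as a double integral: causality restricts it to z.2 <= z.1, and
the truncation v of u to [0, T] to a square. *)
Definition work_kernel (q : R -> R) (z : R * R) : R :=
  if z.2 <= z.1 then q (z.1 - z.2) * v z.2 * v z.1 else 0.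

Lemma integrable_work_kernel (q : R -> R) : continuous q ->
  (mu \x mu)%E.-integrable setT (EFin \o work_kernel q).
Proof.
move=> cq; have [C C0 qC] := continuous_bounded_segment (ltW T_gt0) cq.
apply: (integrable_dominated_tensor (C := C) iv iv).
  apply: measurable_fun_ifT => //.
    exact: (measurable_fun_ler measurable_snd measurable_fst).
  have mv1 := measurableT_comp mv (@measurable_fst _ _ R R).
  have mv2 := measurableT_comp mv (@measurable_snd _ _ R R).
  apply: measurable_funM => //; apply: measurable_funM => //.
  apply: (measurableT_comp (continuous_measurable_fun cq)).
  exact: measurable_funB.
move=> [t s] /=; rewrite /work_kernel /=; case: ifPn => [st|_]; last first.
  by rewrite normr0 mulr_ge0.
have [tT|/v_out ->] := boolP (0 <= t <= T); last by rewrite mulr0 mul0r normr0 mulr0.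
have [sT|/v_out ->] := boolP (0 <= s <= T); last by rewrite !mulr0 mul0r normr0 mulr0.
rewrite -mulrA normrM (mulrC (v s)) ler_wpM2r// qC//; lra.
Qed.

Lemma work_kernel_section (q : R -> R) (t : R) : continuous q ->
  (fun s => work_kernel q (t, s)) =
  (fun s => ((fun s => q (t - s) * u s) \_ `[0, t]) s * v t).
Proof.
move=> cq; apply/funext => s; rewrite /work_kernel /= patchE mem_setE in_itv/=.
have [tT|/v_out ->] := boolP (0 <= t <= T); last by rewrite !mulr0 if_same.
case: (leP 0 s) => [s0|s0] /=; case: (leP s t) => [st|st] /=; rewrite ?mul0r//.
  by rewrite vE// s0 (le_trans st)//; case/andP: tT.
by rewrite v_out ?mulr0 ?mul0r// negb_and -ltNge s0.
Qed.

Lemma integrable_response_integrand (q : R -> R) (t : R) : continuous q ->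
  0 <= t <= T -> mu.-integrable `[0, t] (EFin \o (fun s => q (t - s) * u s)).
Proof.
move=> cq tT; have [C C0 qC] := continuous_bounded_segment (ltW T_gt0) cq.
have ivt : mu.-integrable `[0, t] (EFin \o v) by exact: integrableS iv.
have Evu s : `[0, t]%classic s -> v s = u s.
  rewrite /= in_itv/= => /andP[s0 st]; rewrite vE// s0 (le_trans st)//; by case/andP: tT.
apply: (@eq_integrable _ _ _ mu _ _ (EFin \o (fun s => q (t - s) * v s))) => //.
  by move=> s; rewrite inE => /Evu /= ->.
apply: (le_integrable _ _ _ (integrableZl _ C ivt)) => //.
  apply/measurable_EFinP; apply: measurable_funTS; apply: measurable_funM => //.
  apply: (measurableT_comp (continuous_measurable_fun cq)).
  exact: measurable_funB.
move=> s; rewrite /= in_itv/= => st; rewrite lee_fin !normrM ler_wpM2r//.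
by rewrite (le_trans _ (ler_norm _))// qC//; lra.
Qed.

Lemma fubini_work_kernel (q : R -> R) (t : R) : continuous q ->
  fubini_F mu (EFin \o work_kernel q) t =
  (((fun t => response q u t * u t) \_ `[0, T]) t)%:E.
Proof.
move=> cq; rewrite /fubini_F /=.
under eq_integral => s _ do rewrite (congr1 (fun f => f s) (work_kernel_section t cq)) EFinM.
rewrite patchE mem_setE in_itv/=; case: ifPn => [tT|/v_out ->]; last first.
  by under eq_integral do rewrite mule0; rewrite integral0.
have iq := integrable_response_integrand cq tT.
under eq_integral do rewrite muleC.
rewrite integralZl//; last first.
  rewrite (_ : (fun x => _) = (EFin \o (fun s => q (t - s) * u s)) \_ `[0, t]).
    exact/(integrable_mkcond _ _).1.
  by rewrite restrict_EFin.
rewrite muleC vE// EFinM; congr (_ * _)%E.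
rewrite /response /Rintegral fineK; last exact: integrable_fin_num.
by rewrite [RHS]integral_mkcond/= restrict_EFin.
Qed.

Lemma integrable_work (q : R -> R) : continuous q ->
  mu.-integrable `[0, T] (EFin \o (fun t => response q u t * u t)).
Proof.
move=> cq; apply/(integrable_mkcond _ _).2 => //; rewrite restrict_EFin.
have := integrable_fubini_F (integrable_work_kernel cq).
by apply: eq_integrable => // t _; exact: fubini_work_kernel.
Qed.

Lemma work_prodE (q : R -> R) : continuous q ->
  (work q)%:E = (\int[mu \x mu]_z (work_kernel q z)%:E)%E.
Proof.
move=> cq; rewrite /work /Rintegral fineK.
  rewrite -(integral12_prod_meas1 (integrable_work_kernel cq)) integral_mkcond/=.
  by apply: eq_integral => t _; rewrite restrict_EFin; exact/esym/fubini_work_kernel.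
exact: integrable_fin_num (integrable_work cq).
Qed.

Lemma workD (q1 q2 : R -> R) : continuous q1 -> continuous q2 ->
  work (fun t => q1 t + q2 t) = work q1 + work q2.
Proof.
move=> c1 c2; apply: EFin_inj; rewrite EFinD !work_prodE//; last first.
  by move=> t; apply: cvgD; [exact: c1|exact: c2].
rewrite -integralD//; [|exact: integrable_work_kernel..].
apply: eq_integral => z _; rewrite /work_kernel -EFinD; congr EFin.
by case: ifPn => _; rewrite ?addr0// !mulrDl.
Qed.

Lemma integrable_mul_input (q : R -> R) : continuous q ->
  mu.-integrable setT (EFin \o (fun t => q t * v t)).
Proof.
move=> cq; have [C C0 qC] := continuous_bounded_segment (ltW T_gt0) cq.
apply: (le_integrable _ _ _ (integrableZl _ C iv)) => //.
  apply/measurable_EFinP; apply: measurable_funM => //.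
  exact: continuous_measurable_fun.
move=> t _ /=; rewrite lee_fin !normrM.
have [tT|/v_out ->] := boolP (0 <= t <= T); last by rewrite normr0 !mulr0.
by rewrite ler_wpM2r// (le_trans _ (ler_norm _))// qC.
Qed.

Lemma lossless_work_ge0 (S : lossless_system R) : 0 <= work (impulse_response S).
Proof.
have cphi i : continuous (fun t => free_response S t i 0).
  by move=> t; exact: is_derive1_continuous (expmx_solves_ode _ _ t i).
have cS : continuous (impulse_response S) by exact: continuous_impulse_response.
pose psi i t := free_response S t i 0 * v t.
have ipsi i : mu.-integrable setT (EFin \o psi i) by exact: integrable_mul_input.
rewrite -lee_fin work_prodE//.
rewrite (_ : (\int[_]__ _)%E = (\int[mu \x mu]_z
    \sum_i (if z.2 <= z.1 then psi i z.1 * psi i z.2 else 0)%R%:E)%E); last first.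
  apply: eq_integral => z _; rewrite sumEFin; congr EFin.
  rewrite /work_kernel; case: ifPn => _; last by rewrite big1.
  rewrite impulse_responseB !mulr_suml; apply: eq_bigr => i _.
  by rewrite /psi; ring.
rewrite integral_sum//.
  by apply: sume_ge0 => i _; exact: causal_rank_one_ge0.
move=> i; apply: (integrable_dominated_tensor (C := 1) (ipsi i) (ipsi i)).
  have mpsi : measurable_fun setT (psi i).
    by apply/measurable_EFinP; case/integrableP: (ipsi i).
  apply: measurable_fun_ifT => //.
    exact: (measurable_fun_ler measurable_snd measurable_fst).
  apply: measurable_funM; first exact: (measurableT_comp mpsi measurable_fst).
  exact: (measurableT_comp mpsi measurable_snd).
by move=> z; rewrite mul1r; case: ifPn => // _; rewrite normr0.
Qed.

Lemma le_Rintegral_segment (f : R -> R) (t : R) :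
  mu.-integrable `[0, T] (EFin \o f) -> (forall s, 0 <= f s) -> 0 <= t <= T ->
  \int[mu]_(s in `[0, t]) f s <= \int[mu]_(s in `[0, T]) f s.
Proof.
move=> intf f0 /andP[t0 tT].
by rewrite -subr_ge0 Rintegral_itvB ?bnd_simp// Rintegral_ge0.
Qed.

(** Young's inequality, weighted by e, bounds |q(t - s) u(s)| by
q(t - s)^2 / (2e) + e u(s)^2 / 2; its integral over s is at most e (1 + U) / 2,
where U is the integral of u^2. *)
Lemma work_le_L2 : exists2 K : R, 0 <= K &
  forall (q : R -> R) (e : R), continuous q -> 0 < e ->
    \int[mu]_(t in `[0, T]) q t ^+ 2 <= e ^+ 2 -> `|work q| <= e * K.
Proof.
have subT (t : R) : 0 <= t <= T -> `[0, t]%classic `<=` `[0, T]%classic.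
  by move=> /andP[_ tT]; apply: subset_itvl; rewrite bnd_simp.
have iv2T : mu.-integrable `[0, T] (EFin \o (fun t => v t ^+ 2)) by exact: integrableS iv2.
have iuT : mu.-integrable `[0, T] (EFin \o u).
  by apply/(integrable_mkcond _ _).2 => //; rewrite restrict_EFin.
have iuN : mu.-integrable `[0, T] (EFin \o (fun t => `|u t|)) by exact: integrable_norm.
pose U := \int[mu]_(t in `[0, T]) v t ^+ 2.
pose V := \int[mu]_(t in `[0, T]) `|u t|.
have U0 : 0 <= U by apply: Rintegral_ge0 => t _; exact: sqr_ge0.
have V0 : 0 <= V by exact: Rintegral_ge0.
exists ((1 + U) / 2 * V) => [|q e cq e0 qe]; first by rewrite !mulr_ge0// addr_ge0.
have cq2 : continuous (fun t => q t ^+ 2) by move=> t; exact: (cvgM (cq t) (cq t)).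
have resp t : 0 <= t <= T -> `|response q u t| <= e * ((1 + U) / 2).
  move=> tT; have iq := integrable_response_integrand cq tT.
  have t0 : 0 <= t by case/andP: tT.
  apply: (le_trans (le_normr_Rintegral _ iq)) => //.
  have cqr : continuous (fun s => q (t - s) ^+ 2) by exact: (continuous_reflect cq2).
  have ia : mu.-integrable `[0, t] (EFin \o (fun s => (2 * e)^-1 * q (t - s) ^+ 2)).
    by apply: continuous_integrable_segment => s; apply: cvgMl_tmp; exact: cqr.
  have ib0 : mu.-integrable `[0, t] (EFin \o (fun s => v s ^+ 2)).
    by apply: integrableS iv2T => //; exact: subT.
  have ib : mu.-integrable `[0, t] (EFin \o (fun s => e / 2 * v s ^+ 2)).
    exact: (integrableZl _ (e / 2) ib0).
  apply: (@le_trans _ _ (\int[mu]_(s in `[0, t])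
      ((2 * e)^-1 * q (t - s) ^+ 2 + e / 2 * v s ^+ 2))).
    apply: le_Rintegral => //; first exact: integrable_norm.
      exact: (integrableD _ ia ib).
    move=> s; rewrite /= in_itv/= => /andP[s0 st].
    rewrite vE; last by rewrite s0 (le_trans st)//; case/andP: tT.
    rewrite -[q _ ^+ 2]real_normK ?num_real// -[u _ ^+ 2]real_normK ?num_real// normrM.
    move: (`|q _|) (`|u _|) => x y.
    rewrite -subr_ge0 (_ : _ - _ = (2 * e)^-1 * (x - e * y) ^+ 2); last first.
      by field; rewrite gt_eqF.
    by rewrite mulr_ge0 ?sqr_ge0// invr_ge0 mulr_ge0// ltW.
  have icqr := @continuous_integrable_segment R _ 0 t cqr.
  rewrite RintegralD// RintegralZl// RintegralZl// (Rintegral_reflect cq2 t0).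
  have q2t : \int[mu]_(s in `[0, t]) q s ^+ 2 <= e ^+ 2.
    apply: le_trans qe; apply: le_Rintegral_segment => //.
      exact: continuous_integrable_segment.
    by move=> s; exact: sqr_ge0.
  have v2t : \int[mu]_(s in `[0, t]) v s ^+ 2 <= U.
    by apply: le_Rintegral_segment => // s; exact: sqr_ge0.
  have split_e (x : R) : e * ((1 + x) / 2) = (2 * e)^-1 * e ^+ 2 + e / 2 * x.
    by field; rewrite gt_eqF.
  rewrite split_e.
  by apply: lerD; rewrite ler_wpM2l// ?invr_ge0 ?divr_ge0 ?mulr_ge0// ltW.
have iw := integrable_work cq.
apply: (le_trans (le_normr_Rintegral _ iw)) => //.
rewrite mulrA -RintegralZl//; apply: le_Rintegral => //.
- exact: integrable_norm.
- exact: (integrableZl _ (e * ((1 + U) / 2)) iuN).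
- by move=> t; rewrite /= in_itv/= => tT; rewrite normrM ler_wpM2r// resp.
Qed.

End Work.

Lemma lossless_limit_dissipative (R : realType) (g G : R -> R) :
  continuous G -> (forall t : R, 0 <= t -> G t = g t) ->
  (forall eps tau : R, 0 < eps -> 0 < tau ->
     exists S : lossless_system R,
       (L2norm_on `[0%R, tau] (fun t => (g t - impulse_response S t)%R) <= eps%:E)%E) ->
  dissipative g.
Proof.
move=> cG GE approx T + u u_adm; rewrite le_eqVlt => /predU1P[<-|T_gt0].
  by rewrite set_itv1 Rintegral_set1.
have [K K0 workK] := work_le_L2 T_gt0 u_adm.
rewrite (_ : Rintegral _ _ _ = work T u G); last first.
  apply: eq_Rintegral => t; rewrite inE/= in_itv/= => /andP[t0 _]; congr (_ * _).
  apply: eq_Rintegral => s; rewrite inE/= in_itv/= => /andP[_ st].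
  by rewrite GE// subr_ge0.
apply/ler_addgt0Pl => d d0.
(* K may be 0 *)
have e0 : 0 < d / (K + 1) by rewrite divr_gt0// ltr_wpDl.
have [S hS] := approx _ _ e0 T_gt0.
have cS := continuous_impulse_response (S := S).
have cd : continuous (fun t => G t - impulse_response S t).
  by move=> t; apply: cvgB; [exact: cG|exact: cS].
have dL2 : \int[lebesgue_measure]_(t in `[0, T]) (G t - impulse_response S t) ^+ 2
    <= (d / (K + 1)) ^+ 2.
  move: hS; rewrite (eq_L2norm_on (f2 := fun t => G t - impulse_response S t)); last first.
    by move=> t; rewrite inE/= in_itv/= => /andP[t0 _]; rewrite GE.
  rewrite (L2norm_on_le _ _ (ltW e0)) => hS; rewrite -lee_fin /Rintegral fineK//.
  apply: integrable_fin_num => //; apply: continuous_integrable_segment => t.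
  exact: (cvgM (cd t) (cd t)).
have := workK _ _ cd e0 dL2.
have -> : work T u G = work T u (impulse_response S) +
    work T u (fun t => G t - impulse_response S t).
  rewrite -workD//; congr work; apply/funext => t; ring.
have := lossless_work_ge0 T_gt0 u_adm S.
have : d / (K + 1) * K <= d.
  by rewrite mulrAC ler_pdivrMr ?ltr_wpDl// (ler_wpM2l (ltW d0))// lerDl.
rewrite ler_norml => ? ? /andP[? _]; lra.
Qed.

(** * The equivalence *)

Theorem theorem1 (R : realType) (g : R -> R)
  (g_L1 : in_Lp `]0, +oo[ 1%E g)
  (g_L2 : in_Lp `]0, +oo[ 2%:E g)
  (dg_L1 : derivative_in_L1 g) :
  dissipative g <->
  (forall eps tau : R, 0 < eps -> 0 < tau ->
     exists G_tau : lossless_system R,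
       (L2norm_on `[0%R, tau]
          (fun t => (g t - impulse_response G_tau t)%R) <= eps%:E)%E).
Proof.
have [g_ac _] := dg_L1; pose G := extend_left g.
have cG : continuous G by exact: continuous_extend_left.
have GE (t : R) : 0 <= t -> G t = g t by exact: extend_leftE.
split=> [dg eps tau eps0 tau0|]; last exact: (lossless_limit_dissipative cG GE).
have e0 : 0 < eps / Num.sqrt tau by rewrite divr_gt0// sqrtr_gt0.
have [S hS] := dissipative_uniform_approx g_ac dg e0 tau0.
exists S.
rewrite (eq_L2norm_on (f2 := fun t => G t - impulse_response S t)); last first.
  by move=> t; rewrite inE/= in_itv/= => /andP[t0 _]; rewrite GE.
rewrite (_ : eps = eps / Num.sqrt tau * Num.sqrt tau); last first.
  by rewrite divfK// gt_eqF// sqrtr_gt0.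
apply: L2norm_on_segment_le; [|exact: ltW|exact: ltW|].
  move=> t; apply: cvgB; first exact: cG.
  exact: continuous_impulse_response.
by move=> t tt; case/andP: (tt) => t0 _; rewrite GE// hS.
Qed.
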